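(* Let $\mathbb{F}$ be a finite field with $t$ elements, let $n,m\in\mathbb{N}$, and let $\boldsymbol\tau=(\tau_1,\dots,\tau_n)\in\mathbb{R}^n$ satisfy $\min_{1\le j\le n}\tau_j>1$ and $\sum_{j=1}^n\tau_j\ge n+m$. For $1\le j\le n$ let $$s_j(\boldsymbol\tau)=n(m-1)+\frac{m+n-\sum_{r:\tau_r<\tau_j}(\tau_r-\tau_j)}{\tau_j}.$$ Then $$\dim_HW^{\mathcal{L}}_{n,m}(\boldsymbol\tau)=\min\{s_1(\boldsymbol\tau),\dots,s_n(\boldsymbol\tau)\}.$$
   Context: $\mathcal{L}$ is the field of formal Laurent series $\sum_{i=-n}^\infty a_{-i}X^{-i}$ ($n\in\mathbb{Z}$, coefficients in $\mathbb{F}$, $a_n\ne0$) together with $0$, with absolute value $\left\|\sum_{i=-n}^\infty a_{-i}X^{-i}\right\|=t^n$ and $\|0\|=0$. For vectors, $\|\mathbf x\|_\infty=\max_i\|x_i\|$; for $x\in\mathcal{L}$, $|\langle x\rangle|=\min_{p\in\mathbb{F}[X]}\|x-p\|$. $I_{\mathcal{L}}=\{x\in\mathcal{L}:\|x\|<1\}$ and $I_{\mathcal{L}}^{m\times n}$ is the set of $m\times n$ matrices with entries in $I_{\mathcal{L}}$, with the metric given by the maximum over entries of $\|\cdot\|$; $A_j$ is the $j$-th column of $A$. The set is $$W^{\mathcal{L}}_{n,m}(\boldsymbol\tau)=\left\{A\in I_{\mathcal{L}}^{m\times n}:|\langle\mathbf qA_j\rangle|<\|\mathbf q\|_\infty^{-\tau_j}\|\mathbf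 q\|_\infty\ (1\le j\le n)\text{ for infinitely many }\mathbf q\in\mathbb{F}[X]^m\right\}.$$ $\dim_H$ is Hausdorff dimension with respect to this metric. *)

(* Defs.v *)
From HB Require Import structures.
From mathcomp Require Import all_boot all_order all_algebra.
From mathcomp Require Import all_classical all_reals all_analysis.
From mathcomp Require Import zify ring.

Set Implicit Arguments.
Unset Strict Implicit.
Unset Printing Implicit Defensive.

Import Order.TTheory GRing.Theory Num.Theory.
Local Open Scope classical_set_scope.
Local Open Scope ring_scope.

Section LaurentField.
Variable F : fieldType.

(* [lcoef x k] is the coefficient of X^k, so that a series
   \sum_(i >= -n) a_(-i) X^(-i) has finitely many positive exponents and
   possibly infinitely many negative ones. *)
Record laurent := Laurent {
  lcoef :> int -> F;
  laurentP : exists N : int, forall k, N < k -> lcoef k = 0 }.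

HB.instance Definition _ := gen_eqMixin laurent.
HB.instance Definition _ := gen_choiceMixin laurent.

Lemma laurent_eqP (x y : laurent) : x =1 y -> x = y.
Proof.
case: x y => [x Nx] [y Ny] /= /funext xy; subst y.
by congr Laurent; exact: Prop_irrelevance.
Qed.

Definition ubd (x : int -> F) (N : int) := forall k, N < k -> x k = 0.

Lemma ubdW x M N : M <= N -> ubd x M -> ubd x N.
Proof. by move=> MN xM k Nk; apply: xM; exact: le_lt_trans Nk. Qed.

Definition lzero := @Laurent (fun=> 0) (ex_intro _ 0 (fun _ _ => erefl)).

Lemma ladd_subproof (x y : laurent) : exists N, ubd (fun k => x k + y k) N.
Proof.
have [[M xM] [N yN]] := (laurentP x, laurentP y).
exists (Num.max M N) => k; rewrite gt_max => /andP[Mk Nk].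
by rewrite xM// yN// addr0.
Qed.
Definition ladd x y := Laurent (ladd_subproof x y).

Lemma lopp_subproof (x : laurent) : exists N, ubd (fun k => - x k) N.
Proof. by have [M xM] := laurentP x; exists M => k /xM ->; rewrite oppr0. Qed.
Definition lopp x := Laurent (lopp_subproof x).

Lemma laddA : associative ladd.
Proof. by move=> x y z; apply: laurent_eqP => k /=; rewrite addrA. Qed.
Lemma laddC : commutative ladd.
Proof. by move=> x y; apply: laurent_eqP => k /=; rewrite addrC. Qed.
Lemma ladd0 : left_id lzero ladd.
Proof. by move=> x; apply: laurent_eqP => k /=; rewrite add0r. Qed.
Lemma laddN : left_inverse lzero lopp ladd.
Proof. by move=> x; apply: laurent_eqP => k /=; rewrite addNr. Qed.

HB.instance Definition _ :=
  GRing.isZmodule.Build laurent laddA laddC ladd0 laddN.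

(* Cauchy product; the sum over all integers has finite support as soon as
   both supports are bounded above. *)
Definition conv (x y : int -> F) (k : int) : F :=
  \sum_(i \in [set: int]) x i * y (k - i).

Lemma convE x y M N k (d : nat) : ubd x M -> ubd y N -> N < k - M + d%:Z ->
  conv x y k = \sum_(i < d) x (M - i%:Z) * y (k - M + i%:Z).
Proof.
move=> xM yN kd; rewrite /conv (fsbigE [seq M - i%:Z | i <- iota 0 d]).
- rewrite big_map -(big_mkord xpredT (fun i => x (M - i%:Z) * y (k - M + i%:Z))).
  rewrite /index_iota subn0; apply: congr_big => // i; first by rewrite in_setT.
  by move=> _; congr (_ * y _); ring.
- by rewrite map_inj_uniq ?iota_uniq// => i j /addrI/oppr_inj[].
- by [].
- move=> i _ /mapP id.
  have [/xM ->|iM] := ltP M i; first by rewrite mul0r.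
  rewrite (yN (k - i)) ?mulr0// ltNge; apply/negP => kiN; apply: id.
  exists (absz (M - i)); last by lia.
  by rewrite mem_iota; lia.
Qed.

Lemma conv_ubd x y M N : ubd x M -> ubd y N -> ubd (conv x y) (M + N).
Proof.
move=> xM yN k kMN; rewrite (@convE x y M N k 0) ?big_ord0//; lia.
Qed.

Lemma lmul_subproof (x y : laurent) : exists N, ubd (conv x y) N.
Proof.
have [[M xM] [N yN]] := (laurentP x, laurentP y).
by exists (M + N); exact: conv_ubd.
Qed.
Definition lmul x y := Laurent (lmul_subproof x y).

Lemma lone_subproof : exists N, ubd (fun k => (k == 0)%:R) N.
Proof. by exists 0 => k; rewrite lt0r => /andP[/negPf ->]. Qed.
Definition lone := Laurent lone_subproof.

Lemma lmulC : commutative lmul.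
Proof.
move=> x y; apply: laurent_eqP => k /=; rewrite /conv.
rewrite (@reindex_fsbigT _ _ _ _ _ (fun i => k - i)) /=; last first.
  by exists (fun i => k - i) => i; ring.
by apply: eq_fsbigr => i _; rewrite mulrC; congr (y _ * _); ring.
Qed.

Lemma lmulA : associative lmul.
Proof.
move=> x y z; apply: laurent_eqP => k /=.
have [[[M xM] [N yN]] [P zP]] := (laurentP x, laurentP y, laurentP z).
pose d := (absz (P + M + N - k)%R).+1.
have xyb := conv_ubd xM yN; have yzb := conv_ubd yN zP.
rewrite (@convE _ _ M (N + P) k d xM yzb); last by rewrite /d; lia.
rewrite (@convE _ _ (M + N) P k d xyb zP); last by rewrite /d; lia.
transitivity (\sum_(i < d) \sum_(j < d)
    x (M - j%:Z) * y (M + N - i%:Z - M + j%:Z) * z (k - (M + N) + i%:Z)).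
  rewrite exchange_big /=; apply: eq_bigr => j _.
  have yNj : ubd y (N + j%:Z) by apply: ubdW yN; lia.
  rewrite (@convE _ _ _ _ _ d yNj zP); last by rewrite /d; lia.
  rewrite mulr_sumr; apply: eq_bigr => i _; rewrite mulrA.
  by congr (_ * y _ * z _); ring.
apply: eq_bigr => i _; rewrite (@convE _ _ M N _ d xM yN); last first.
  by have := ltn_ord i; lia.
by rewrite mulr_suml.
Qed.

Lemma lmul1 : left_id lone lmul.
Proof.
move=> x; apply: laurent_eqP => k /=; rewrite /conv.
rewrite (fsbigE [:: 0])//=.
  by rewrite big_cons big_nil in_setT /= mul1r subr0 addr0.
by move=> i _; rewrite inE => /negPf ->; rewrite mul0r.
Qed.

Lemma lmulD : left_distributive lmul ladd.
Proof.
move=> x y z; apply: laurent_eqP => k /=.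
have [[[M xM] [N yN]] [P zP]] := (laurentP x, laurentP y, laurentP z).
pose S := Num.max M N; pose d := (absz (P + S - k)%R).+1.
have xS : ubd x S by apply: ubdW xM; rewrite le_max lexx.
have yS : ubd y S by apply: ubdW yN; rewrite le_max lexx orbT.
have xyS : ubd (fun k => x k + y k) S.
  by move=> i Si; rewrite xS// yS// addr0.
have kd : P < k - S + d%:Z by rewrite /d; lia.
rewrite (convE xyS zP kd) (convE xS zP kd) (convE yS zP kd).
by rewrite -big_split; apply: eq_bigr => i _; rewrite mulrDl.
Qed.

Lemma lone_neq0 : lone != 0 :> laurent.
Proof.
by apply/eqP => /(congr1 (fun x : laurent => x 0)) /= /eqP; rewrite oner_eq0.
Qed.

HB.instance Definition _ := GRing.Zmodule_isComNzRing.Build laurent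
  lmulA lmulC lmul1 lmulD lone_neq0.

(* [is_ldeg x k]: X^k is the leading monomial of x. *)
Definition is_ldeg (x : laurent) (k : int) : Prop :=
  x k != 0 /\ forall j, k < j -> x j = 0.

Lemma ldeg_ex (x : laurent) : x != 0 -> exists k, is_ldeg x k.
Proof.
move=> x0; have [N xN] := laurentP x.
have [k xk] : exists k, x k != 0.
  apply: contrapT => /forallNP h; move/negP: x0; apply; apply/eqP.
  by apply: laurent_eqP => k; apply/eqP; apply: contrapT => /negP /h.
have kN : k <= N by rewrite leNgt; apply/negP => /xN xk0; rewrite xk0 eqxx in xk.
have ex : exists n : nat, x (N - n%:Z) != 0.
  exists (absz (N - k)); suff -> : N - (absz (N - k))%:Z = k by [].
  by lia.
case: (ex_minnP ex) => n xn min_n; exists (N - n%:Z); split=> // j nj.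
have [/xN//|jN] := ltP N j; apply/eqP/negPn/negP => xj.
have jE : N - (absz (N - j))%:Z = j by lia.
by have := min_n (absz (N - j)); rewrite jE => /(_ xj); lia.
Qed.

Definition ldeg (x : laurent) : int := xget 0 [set k | is_ldeg x k].

Lemma ldegP (x : laurent) : x != 0 -> is_ldeg x (ldeg x).
Proof. by move=> /ldeg_ex; exact: (@xgetPex _ 0 [set k | is_ldeg x k]). Qed.

Lemma ldeg_eq (x : laurent) k : is_ldeg x k -> ldeg x = k.
Proof.
move=> xk; have [xl0 xl1] := @xgetPex _ 0 [set k | is_ldeg x k] (ex_intro _ k xk).
have [xk0 xk1] := xk; apply/eqP; rewrite eq_le !leNgt; apply/andP; split.
  by apply/negP => /xk1 /eqP; apply/negP.
by apply/negP => /xl1 /eqP; apply/negP.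
Qed.

(* Coefficients of the inverse of c + a_1 T + a_2 T^2 + ..., where
   T = X^-1 and a_0 is ignored. *)
Fixpoint invs (c : F) (a : nat -> F) (n : nat) : seq F :=
  if n is m.+1 then
    rcons (invs c a m)
      (c^-1 * ((m == 0)%:R - \sum_(i < m) a i.+1 * (invs c a m)`_(m - i.+1)))
  else [::].

Lemma size_invs c a n : size (invs c a n) = n.
Proof. by elim: n => //= n IH; rewrite size_rcons IH. Qed.

Lemma nth_invs c a m n : (n < m)%N -> (invs c a m)`_n = (invs c a n.+1)`_n.
Proof.
elim: m => // m IH; rewrite ltnS leq_eqVlt => /orP[/eqP -> //|nm].
by rewrite [in LHS]/= nth_rcons size_invs nm IH.
Qed.

Lemma linv_ex (x : laurent) : x != 0 -> exists y : laurent, y * x = 1.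
Proof.
move=> /ldegP; set M := ldeg x => -[xM xgt].
pose a (i : nat) := x (M - i%:Z).
pose u (n : nat) := (invs (x M) a n.+1)`_n.
pose f (k : int) := if k <= - M then u (absz (- M - k)) else 0.
have fM : ubd f (- M) by move=> k; rewrite /f ltNge => /negPf ->.
exists (Laurent (ex_intro _ _ fM)); rewrite mulrC; apply: laurent_eqP => k.
change (conv x f k = (k == 0)%:R).
have [k0|k0] := ltP 0 k.
  by rewrite (conv_ubd xgt fM) ?subrr// (negPf (lt0r_neq0 k0)).
pose m := absz k; have -> : k = - m%:Z by rewrite /m; lia.
rewrite (@convE _ _ M (- M) _ m.+1)//; last by lia.
have fE (i : nat) : (i <= m)%N -> f (- m%:Z - M + i%:Z) = u (m - i)%N.
  by move=> im; rewrite /f ifT; [congr u|]; lia.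
rewrite big_ord_recl /= subr0 (fE 0)// subn0.
rewrite [X in _ * X](_ : _ = (x M)^-1 *
    ((m == 0)%:R - \sum_(i < m) a i.+1 * (invs (x M) a m)`_(m - i.+1))).
  rewrite mulVKf// (_ : (- m%:Z == 0) = (m == 0)); last by lia.
  rewrite [X in _ + X](_ : _ = \sum_(i < m) a i.+1 * (invs (x M) a m)`_(m - i.+1)).
    by rewrite subrK.
  apply: eq_bigr => i _; have := ltn_ord i => im.
  rewrite /bump /= add1n fE// /a /u nth_invs//; lia.
by rewrite /u /= nth_rcons size_invs ltnn eqxx.
Qed.

Definition linv (x : laurent) : laurent :=
  if x == 0 then 0 else xget 0 [set y : laurent | y * x = 1].

Lemma lmulV (x : laurent) : x != 0 -> linv x * x = 1.
Proof.
move=> x0; rewrite /linv (negPf x0).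
exact: (@xgetPex _ 0 [set y : laurent | y * x = 1] (linv_ex x0)).
Qed.

Lemma linv0 : linv 0 = 0.
Proof. by rewrite /linv eqxx. Qed.

HB.instance Definition _ := GRing.ComNzRing_isField.Build laurent lmulV linv0.

Lemma lpoly_subproof (p : {poly F}) :
  exists N, ubd (fun k : int => if 0 <= k then p`_(absz k) else 0) N.
Proof.
exists (size p)%:Z => -[k|k] //=; rewrite ltz_nat => pk.
by rewrite nth_default// ltnW.
Qed.
Definition lpoly (p : {poly F}) : laurent := Laurent (lpoly_subproof p).

End LaurentField.

Section Norm.
Variables (R : realType) (F : finFieldType).

Definition lnorm (x : laurent F) : R :=
  if x == 0 then 0 else #|F|%:R ^ (ldeg x).

Definition vnorm (m : nat) (v : 'rV[laurent F]_m) : R :=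
  \big[Num.max/0]_(i < m) lnorm (v 0 i).

Definition mxdist (m n : nat) (A B : 'M[laurent F]_(m, n)) : R :=
  \big[Num.max/0]_(i < m) \big[Num.max/0]_(j < n) lnorm (A i j - B i j).

(* The infimum is a minimum, see [ldistP] and [ldist_le]. *)
Definition ldist (x : laurent F) : R :=
  inf [set lnorm (x - lpoly p) | p in [set: {poly F}]].

Lemma lnorm_ge0 x : 0 <= lnorm x.
Proof. by rewrite /lnorm; case: ifP => // _; rewrite exprz_ge0. Qed.

Lemma card_gt1 : 1 < #|F|%:R :> R.
Proof. by rewrite ltr1n card_finNzRing_gt1. Qed.

Lemma lnorm_leP (x : laurent F) (N : int) :
  reflect (forall k, N < k -> x k = 0) (lnorm x <= #|F|%:R ^ N).
Proof.
rewrite /lnorm; case: eqVneq => [->|x0].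
  rewrite exprz_ge0//; exact: ReflectT.
have [x1 x2] := ldegP x0; rewrite ler_eXz2l ?card_gt1//.
apply: (iffP idP) => [xN k Nk|h]; first by apply: x2; exact: le_lt_trans Nk.
by rewrite leNgt; apply/negP => /h /eqP; apply/negP.
Qed.

Lemma lnorm_eq0 x : (lnorm x == 0) = (x == 0).
Proof.
rewrite /lnorm; case: (x == 0); first by rewrite eqxx.
by apply/negbTE/lt0r_neq0/exprz_gt0; exact: lt_trans card_gt1.
Qed.

Lemma lnormN x : lnorm (- x) = lnorm x.
Proof.
rewrite /lnorm oppr_eq0; case: eqVneq => // x0; congr (_ ^ _).
apply: ldeg_eq; have [x1 x2] := ldegP x0; split; first by rewrite /= oppr_eq0.
by move=> j /x2 /= ->; rewrite oppr0.
Qed.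

Lemma lnormD x y : lnorm (x + y) <= Num.max (lnorm x) (lnorm y).
Proof.
have h (N : int) : lnorm x <= #|F|%:R ^ N -> lnorm y <= #|F|%:R ^ N ->
    lnorm (x + y) <= #|F|%:R ^ N.
  move=> /lnorm_leP xN /lnorm_leP yN; apply/lnorm_leP => k Nk /=.
  by rewrite xN// yN// addr0.
have [->|x0] := eqVneq x 0; first by rewrite add0r le_max lexx orbT.
have [->|y0] := eqVneq y 0; first by rewrite addr0 le_max lexx.
have [xy|/ltW yx] := leP (lnorm x) (lnorm y).
  have E : lnorm y = #|F|%:R ^ (ldeg y) by rewrite /lnorm (negPf y0).
  by rewrite E; apply: h; rewrite -E.
have E : lnorm x = #|F|%:R ^ (ldeg x) by rewrite /lnorm (negPf x0).
by rewrite E; apply: h; rewrite -E.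
Qed.

Lemma ldist_le x p : ldist x <= lnorm (x - lpoly p).
Proof.
apply: ge_inf; last by exists p.
by exists 0 => _ [q _ <-]; exact: lnorm_ge0.
Qed.

Lemma ldistP x : exists p, ldist x = lnorm (x - lpoly p).
Proof.
have [N xN] := laurentP x.
pose p := \poly_(i < (absz N).+1) x i%:Z.
have pE k : 0 <= k -> lpoly p k = x k.
  move=> k0 /=; rewrite k0 coef_poly; case: ltnP => Nk.
    by congr (x _); lia.
  by rewrite xN//; lia.
exists p; apply/eqP; rewrite eq_le ldist_le /=.
apply: lb_le_inf; first by exists (lnorm (x - lpoly 0)), 0.
move=> _ [q _ <-]; have [xq0|xq0] := leP (lnorm (x - lpoly q)) (#|F|%:R ^ (-1)).
  rewrite (_ : p = q)//; apply/polyP => i.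
  have /lnorm_leP/(_ i%:Z) := xq0.
  have /= := pE i%:Z isT => pi h.
  by rewrite pi; apply/eqP; rewrite -subr_eq0; apply/eqP; apply: h; lia.
apply: le_trans (ltW xq0); apply/lnorm_leP => k Nk.
by have /= := @pE k _ => -> /=; [rewrite subrr|lia..].
Qed.

Definition unit_ball (m n : nat) : set 'M[laurent F]_(m, n) :=
  [set A | forall i j, lnorm (A i j) < 1].

(* At q = 0 both sides of the inequality vanish since [0 `^ a] is 0 for
   a != 0; a single q does not affect the set anyway. *)
Definition W (m n : nat) (tau : 'I_n -> R) : set 'M[laurent F]_(m, n) :=
  [set A | unit_ball A /\
    infinite_set [set q : 'rV[{poly F}]_m | forall j : 'I_n,
      let q' := map_mx (@lpoly F) q in
      ldist ((q' *m col j A) 0 0) < vnorm q' `^ (- tau j) * vnorm q']].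

End Norm.

Section Hausdorff.
Variables (R : realType) (T : Type) (d : T -> T -> R).
Local Open Scope ereal_scope.

(* Adjoining 0 gives the empty set diameter 0 instead of -oo. *)
Definition diam (U : set T) : \bar R :=
  ereal_sup (0 |` [set (d p.1 p.2)%:E | p in U `*` U]).

(* The convention 0^0 = 1 of [poweR] is the right one for points (it makes the
   0-dimensional measure the counting measure), not for the empty set. *)
Definition hcost (s : R) (U : set T) : \bar R :=
  if U == set0 then 0 else diam U `^ s.

Definition hcover (delta : R) (A : set T) : set (nat -> set T) :=
  [set U | A `<=` \bigcup_i U i /\ forall i, diam (U i) <= delta%:E].

Definition hpremeasure (s delta : R) (A : set T) : \bar R :=
  ereal_inf [set \sum_(0 <= i <oo) hcost s (U i) | U in hcover delta A].

Definition hmeasure (s : R) (A : set T) : \bar R :=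
  ereal_sup [set hpremeasure s delta A | delta in [set e : R | (0 < e)%R]].

Definition hdim (A : set T) : \bar R :=
  ereal_inf [set s%:E | s in [set s : R | (0 <= s)%R /\ hmeasure s A = 0]].

End Hausdorff.

Definition dim_exponent (R : realType) (m n : nat) (tau : 'I_n -> R)
    (j : 'I_n) : R :=
  n%:R * (m%:R - 1)
  + (m%:R + n%:R - \sum_(r < n | tau r < tau j) (tau r - tau j)) / tau j.

(* Main.v *)
Require Import Defs.
From mathcomp Require Import all_boot all_order all_algebra.
From mathcomp Require Import all_classical all_reals all_analysis.
From mathcomp Require Import zify ring lra.
Import Order.TTheory GRing.Theory Num.Theory.

(** A matrix over the unit ball is an array of digits, one infinite sequence
    per entry, and the balls of the metric are the cylinders: the sets of
    arrays with a prescribed prefix of each entry. The polynomial vector q of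
    degree d gives a good approximation of the column A_j when the first
    digits of the fractional part of q A_j vanish, about (tau_j - 1) d of
    them. This is a linear system in the digits of A_j. It is triangular: the
    digit l of q A_j is the first to involve the digit l + d of a row in which
    q has degree d. Hence every equation divides the number of admissible
    prefixes by t = #|F|, exactly, and all measure estimates reduce to counting.

    Upper bound ([hdim_W_le]). Fix j and cover, for each d, the matrices
    approximated by some q of degree d with cylinders of length about tau_j d,
    which resolves the equations of the column j. There are about t^(m d)
    vectors q, and the count of the cylinders shows that their cost with
    exponent s is geometric in d, with a ratio less than 1 when s exceeds s_j.

    Lower bound ([hdim_W_ge]). The function [profile] satisfies
    s_j = n (m - 1) + profile (tau_j) / tau_j; it is piecewise linear with
    breaks at the tau_j, so that profile u >= v u for all u, where
    v = min_j profile (tau_j) / tau_j ([profile_ge]). Let s < n (m - 1) + v.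
    Inside a cylinder of length b and for K large, the pigeonhole principle
    provides for each prefix x some q of degree at most K for which the first
    rho_j digits of q x_j vanish, where rho_1 + ... + rho_n is about m K. By
    counting, for half of the prefixes the degree of q is K up to a bounded
    error ([many_good]). Changing the digits of x in one row forces further
    digits of q x_j to vanish, sigma_j > (tau_j - 1) K altogether. The uniform
    measure on the prefixes x is thereby pushed to a measure carried by finitely
    many small cylinders on which q is as good as required, and the mass of a
    cylinder of length l is bounded by a constant times t^(- s (l - b)), with a
    constant that depends only on m and n ([concentrate]). The levels rho_j are
    obtained by cutting the sigma_j at a common height, and the bound is then
    exactly the inequality for [profile] at u = l / K ([profile_defect]).

    No limit measure is built from these finite ones. Given a cover of small
    cost by sets, which may be taken to be cylinders, [safe_step] finds by
    averaging one small cylinder that is not swallowed by the cover and in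
    which the remaining cover is again cheap. Iterating, the cylinders shrink
    to a point of W outside the cover ([avoidance]), so that W has positive
    s-dimensional measure ([hmeasure_W_neq0]). *)

Set Implicit Arguments.
Unset Strict Implicit.
Unset Printing Implicit Defensive.

Local Open Scope ring_scope.

(** * Digit arrays and counting *)

Section Arrays.
Variables (F : finFieldType) (I : finType).
Implicit Types a : I -> nat -> F.

Definition agree (l : nat) a a' := forall i p, (p < l)%N -> a i p = a' i p.

Lemma agree_sym l a a' : agree l a a' -> agree l a' a.
Proof. by move=> h i p pl; rewrite h. Qed.

Lemma agree_trans l a a' a'' : agree l a a' -> agree l a' a'' -> agree l a a''.
Proof. by move=> h h' i p pl; rewrite h// h'. Qed.

Lemma agreeW l l' a a' : (l <= l')%N -> agree l' a a' -> agree l a a'.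
Proof. by move=> ll' h i p pl; apply: h; exact: leq_trans ll'. Qed.

Definition extend (N : nat) (x : {ffun I * 'I_N -> F}) : I -> nat -> F :=
  fun i p => if insub p is Some u then x (i, u) else 0.

Definition truncate (N : nat) a : {ffun I * 'I_N -> F} :=
  [ffun u => a u.1 (u.2 : 'I_N)].

Lemma extend_ord N (x : {ffun I * 'I_N -> F}) i (p : 'I_N) :
  extend x i p = x (i, p).
Proof. by rewrite /extend valK. Qed.

Lemma extend_ge N (x : {ffun I * 'I_N -> F}) i p : (N <= p)%N -> extend x i p = 0.
Proof. by move=> Np; rewrite /extend insubF// ltnNge Np. Qed.

Lemma extend_truncate N a : agree N (extend (truncate N a)) a.
Proof.
by move=> i p pN; rewrite -[p]/(val (Ordinal pN)) extend_ord ffunE.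
Qed.

Lemma extend_inj N (x y : {ffun I * 'I_N -> F}) :
  agree N (extend x) (extend y) -> x = y.
Proof.
by move=> h; apply/ffunP => -[i p]; rewrite -!extend_ord; apply: h.
Qed.

(** The source of all upper bounds on numbers of prefixes: a family cut out by
    triangular equations is injected into the values at the positions that the
    equations leave free. *)
Lemma card_determined N (E : {set {ffun I * 'I_N -> F}}) (P : I -> nat -> bool) :
  (forall x y, x \in E -> y \in E ->
    (forall i p, (p < N)%N -> P i p -> extend x i p = extend y i p) -> x = y) ->
  (#|E| <= #|F| ^ (\sum_(i : I) \sum_(p < N) P i p))%N.
Proof.
move=> inj.
pose Fr := [set u : I * 'I_N | P u.1 u.2].
have -> : (\sum_(i : I) \sum_(p < N) P i p)%N = #|Fr|.
  rewrite pair_bigA /= -sum1_card [RHS]big_mkcond /=.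
  by apply: eq_bigr => u _; rewrite inE; case: (P _ _).
pose f (x : {ffun I * 'I_N -> F}) := [ffun u => if u \in Fr then x u else 0].
rewrite -(card_pffun_on (0 : F) [in Fr] [in predT]).
rewrite -(@card_in_imset _ _ f); last first.
  move=> x y xE yE /ffunP fxy; apply: inj => // i p pN Pip.
  have /= := fxy (i, Ordinal pN); rewrite !ffunE inE /= Pip.
  by rewrite -!extend_ord.
apply: subset_leq_card; apply/fintype.subsetP => _ /imsetP[x _ ->].
apply/pffun_onP; split=> //; apply/fintype.subsetP => u.
by rewrite inE ffunE; case: ifP => //; rewrite eqxx.
Qed.

End Arrays.

Lemma sum_interval (N a b : nat) : (b <= N)%N ->
  (\sum_(p < N) (a <= p < b) = b - a)%N.
Proof.
move=> bN; rewrite -(big_mkord xpredT (fun p => nat_of_bool (a <= p < b)%N)).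
elim: N b bN => [|N IH] b.
  by rewrite leqn0 => /eqP ->; rewrite big_geq.
rewrite leq_eqVlt => /orP[/eqP ->|bN]; rewrite big_nat_recr//=.
  rewrite (eq_big_nat _ _ (F2 := fun p => nat_of_bool (a <= p < N)%N)); last first.
    by move=> p pN; congr nat_of_bool; lia.
  by rewrite IH//; lia.
by rewrite IH//; lia.
Qed.

Lemma sum_above (N a : nat) : (\sum_(p < N) (a <= p) = N - a)%N.
Proof.
rewrite -(@sum_interval N a N)//; apply: eq_bigr => p _.
by rewrite ltn_ord andbT.
Qed.

(** * Linear forms acting on digit arrays *)

Section Pairing.
Variables (F : finFieldType) (m : nat).
Implicit Types (c a : 'I_m -> nat -> F).

(** Digit [l], that is the coefficient of X^(-(l+1)), of the linear form with
    polynomial coefficients [c] of degree at most [d] at the point [a]. *)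
Definition pairing (d : nat) c a (l : nat) : F :=
  \sum_(i < m) \sum_(e < d.+1) c i e * a i (l + e)%N.

(** [i0] is a row in which the polynomial vector [c] attains its degree [d]. *)
Definition pivot c (i0 : 'I_m) (d : nat) : Prop :=
  c i0 d != 0 /\ forall i e, (d < e)%N -> c i e = 0.

Lemma pairingB_coef d c c' a l :
  pairing d (fun i e => c i e - c' i e) a l = pairing d c a l - pairing d c' a l.
Proof.
rewrite /pairing -sumrB; apply: eq_bigr => i _.
by rewrite -sumrB; apply: eq_bigr => e _; rewrite mulrBl.
Qed.

Lemma eq_pairing d c c' a a' l :
  (forall i e, (e <= d)%N -> c i e = c' i e) ->
  (forall i p, (p <= l + d)%N -> a i p = a' i p) ->
  pairing d c a l = pairing d c' a' l.
Proof.
move=> cc aa; rewrite /pairing; apply: eq_bigr => i _; apply: eq_bigr => e _.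
have ed := ltn_ord e; rewrite cc; last by lia.
by rewrite aa//; lia.
Qed.

Lemma pairing_widen d d' c a l : (d <= d')%N ->
  (forall i e, (d < e)%N -> c i e = 0) -> pairing d' c a l = pairing d c a l.
Proof.
move=> dd' c0; rewrite /pairing; apply: eq_bigr => i _.
rewrite -(big_mkord xpredT (fun e => c i e * a i (l + e)%N)).
rewrite (big_cat_nat (n := d.+1))//= big_mkord [X in _ + X]big1_seq ?addr0// => e.
by rewrite mem_index_iota => /andP[_ /andP[de _]]; rewrite c0 ?mul0r.
Qed.

(** The system of equations [pairing d c a l = 0] is triangular: among the
    digits involved in equation [l], the one at position [l + d] of the pivot
    row is involved in no earlier equation, and its coefficient [c i0 d] is
    invertible. *)
Lemma pairing_upd d c a i0 l l' z : (l' <= l)%N ->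
  pairing d c (fun i p => a i p + (z *+ ((i == i0) && (p == l + d)%N))) l'
  = pairing d c a l' + (c i0 d * z) *+ (l' == l).
Proof.
move=> l'l; rewrite /pairing.
under eq_bigr => i _ do under eq_bigr => e _ do rewrite mulrDr.
under eq_bigr => i _ do rewrite big_split /=.
rewrite big_split /=; congr (_ + _).
rewrite (bigD1 i0)//= [X in _ + X]big1 ?addr0; last first.
  by move=> i /negPf ->; rewrite big1// => e _; rewrite mulr0n mulr0.
rewrite (bigD1 ord_max)//= big1 ?addr0; last first.
  move=> e; rewrite -val_eqE /= => /negPf ed.
  have -> : (l' + e == l + d)%N = false by have := ltn_ord e; lia.
  by rewrite andbF mulr0n mulr0.
by rewrite eqxx /= eqn_add2r; case: (l' == l); rewrite ?mulr1n// !mulr0n mulr0.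
Qed.

(** Once the digits of the pivot row before [l + d] are known to agree,
    equation [l] has a single unknown left. *)
Lemma pairing_determined d c i0 a a' lo hi : pivot c i0 d ->
  (forall l, (lo <= l < hi)%N -> pairing d c a l = 0) ->
  (forall l, (lo <= l < hi)%N -> pairing d c a' l = 0) ->
  (forall i p, (p < hi + d)%N -> ~~ ((i == i0) && (lo + d <= p)%N) ->
     a i p = a' i p) ->
  forall i p, (p < hi + d)%N -> a i p = a' i p.
Proof.
move=> [ci0 _] ha ha' aa'.
suff row p : (p < hi + d)%N -> a i0 p = a' i0 p.
  move=> i p ph; have [->|ii0] := eqVneq i i0; first exact: row.
  by apply: aa' => //; rewrite (negPf ii0).
elim/ltn_ind: p => p IH ph.
have [pl|lp] := ltnP p (lo + d); first by apply: aa' => //; rewrite eqxx -ltnNge.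
pose l := (p - d)%N; have pE : p = (l + d)%N by rewrite /l; lia.
have lb : (lo <= l < hi)%N by rewrite /l; lia.
have : pairing d c a l - pairing d c a' l = 0 by rewrite ha// ha'// subrr.
rewrite /pairing -sumrB (bigD1 i0)//= [X in _ + X]big1 ?addr0; last first.
  move=> i ii0; rewrite -sumrB big1// => e _.
  rewrite aa' ?subrr//; last by rewrite (negPf ii0).
  by have := ltn_ord e; lia.
rewrite -sumrB (bigD1 ord_max)//= big1 ?addr0; last first.
  move=> e; rewrite -val_eqE /= => ed; have ed' := ltn_ord e.
  by rewrite IH ?subrr//; lia.
rewrite -pE -mulrBr => /eqP; rewrite mulf_eq0 (negPf ci0) /= subr_eq0.
by move/eqP.
Qed.

(** Forward substitution, one equation and one digit of the pivot row at a
    time. *)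
Lemma pairing_solve d c i0 a lo hi : pivot c i0 d ->
  exists a', (forall l, (lo <= l < hi)%N -> pairing d c a' l = 0) /\
    (forall i p, ~~ [&& i == i0, lo + d <= p & p < hi + d]%N -> a' i p = a i p).
Proof.
move=> [ci0 _]; elim: hi => [|hi [a' [ha' aa']]].
  by exists a; split=> // l; rewrite ltn0 andbF.
have [hl|lh] := ltnP hi lo.
  by exists a; split=> // l; lia.
pose z := - (pairing d c a' hi / c i0 d).
exists (fun i p => a' i p + (z *+ ((i == i0) && (p == hi + d)%N))); split.
  move=> l /andP[lol lhi]; rewrite pairing_upd//.
  have [->|lhi'] := eqVneq l hi.
    by rewrite mulr1n /z mulrN mulrC divfK// subrr.
  by rewrite ha' ?mulr0n ?addr0//; lia.
move=> i p; have [->|ii0] /= := eqVneq i i0; last first.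
  by move=> _; rewrite mulr0n addr0 aa'// (negPf ii0).
move=> h; have -> : (p == hi + d)%N = false by lia.
by rewrite mulr0n addr0 aa'// eqxx /=; lia.
Qed.

Lemma pivot_ex K (x : {ffun 'I_m * 'I_K -> F}) : x != [ffun=> 0] ->
  exists i0 d, (d < K)%N /\ pivot (extend x) i0 d.
Proof.
move=> /eqP/ffunP/existsNP[u]; rewrite ffunE => /eqP xu.
case: (@arg_maxnP _ u (fun u => x u != 0) (fun u => val u.2) xu) => -[i0 d] /= xd dmax.
exists i0, d; split=> //; split; first by rewrite extend_ord.
move=> i e de; have [Ke|eK] := leqP K e; first by rewrite extend_ge.
rewrite -[e]/(val (Ordinal eK)) extend_ord; apply/eqP/negPn/negP => /dmax /=.
by rewrite leqNgt de.
Qed.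

End Pairing.

(** * Counting prefixes *)

Section Counting.
Variables (F : finFieldType) (m n : nat).
Local Notation IJ := ('I_m * 'I_n)%type.
Implicit Types (a y : IJ -> nat -> F) (rho sigma : 'I_n -> nat).

Definition column a (j : 'I_n) : 'I_m -> nat -> F := fun i => a (i, j).

Lemma sum_row_interval N (i0 : 'I_m) (lo hi : 'I_n -> nat) :
  (forall j, (hi j <= N)%N) ->
  (\sum_(u : IJ) \sum_(p < N) ((u.1 == i0) && (lo u.2 <= p < hi u.2)%N)
   = \sum_j (hi j - lo j))%N.
Proof.
move=> hiN; rewrite -(pair_bigA _ (fun i j =>
  \sum_(p < N) ((i == i0) && (lo j <= p < hi j)%N))%N) /=.
rewrite (bigD1 i0)//= [X in (_ + X)%N]big1 ?addn0; last first.
  by move=> i /negPf ii0; rewrite big1// => j _; rewrite big1// => p; rewrite ii0.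
by apply: eq_bigr => j _; rewrite eqxx /= sum_interval.
Qed.

Lemma sum_cylinder N b :
  (\sum_(u : IJ) \sum_(p < N) (b <= p) = m * n * (N - b))%N.
Proof.
under eq_bigr => u _ do rewrite sum_above.
by rewrite sum_nat_const card_prod !card_ord.
Qed.

(** Multiplication by a polynomial preserves the uniform distribution of
    fractional parts, so that each equation divides the number of solutions by
    [#|F|]. Equation [l] reaches the digit [l + d], and the first [b - d]
    equations, which the prefix may already decide, are not counted. *)
Lemma card_solutions b N d c i0 rho y (E : {set {ffun IJ * 'I_N -> F}}) :
  pivot c i0 d -> (forall j, rho j + d <= N)%N ->
  (forall x, x \in E -> agree b (extend x) y) ->
  (forall x j l, x \in E -> (l < rho j)%N ->
     pairing d c (column (extend x) j) l = 0) ->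
  (#|E| * #|F| ^ (\sum_j (rho j - (b - d))) <= #|F| ^ (m * n * (N - b)))%N.
Proof.
move=> cpiv rhoN Eb E0; have F0 : (0 < #|F|)%N by apply/card_gt0P; exists 0.
pose lo := (b - d)%N.
pose D (u : IJ) (p : nat) := (u.1 == i0) && (lo + d <= p < rho u.2 + d)%N.
pose P u p := (b <= p)%N && ~~ D u p.
have cE : (#|E| <= #|F| ^ (\sum_(u : IJ) \sum_(p < N) P u p))%N.
  apply: card_determined => x x' xE x'E agP.
  have off u p : (p < N)%N -> ~~ D u p -> extend x u p = extend x' u p.
    move=> pN nD; have [pb|bp] := ltnP p b.
      by rewrite (Eb x xE)// (Eb x' x'E).
    by apply: agP => //; rewrite /P bp.
  apply: extend_inj => -[i j] p pN.
  have [ph|hp] := ltnP p (rho j + d); last first.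
    by apply: off => //; rewrite /D /= (leqNgt _.+1) ltnS hp /= !andbF.
  apply: (@pairing_determined F m d c i0 (column (extend x) j)
    (column (extend x') j) lo (rho j)) => //.
  - by move=> l /andP[_ lr]; apply: E0.
  - by move=> l /andP[_ lr]; apply: E0.
  - move=> i' p' p'h nD; apply: off; first by have := rhoN j; lia.
    by rewrite /D /= p'h andbT.
apply: leq_trans (leq_mul cE (leqnn _)) _.
rewrite -expnD leq_pexp2l//.
rewrite -sum_cylinder -[X in (_ + X <= _)%N](_ : \sum_(u : IJ) \sum_(p < N) D u p = _)%N.
  rewrite -big_split /=; apply: leq_sum => u _.
  rewrite -big_split /=; apply: leq_sum => p _; rewrite /P.
  by case: (boolP (D u p)) => [/andP[_ /andP[]]|] /=; rewrite /lo; case: leqP; lia.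
apply: etrans (@sum_row_interval N i0 (fun=> lo + d)%N (fun j => rho j + d)%N rhoN) _.
by apply: eq_bigr => j _; rewrite subnDr.
Qed.

(** The mass that a cylinder of length [l] receives when the uniform measure
    on [E] is pushed by [phi]: [phi x] forgets the digits of [x] in the row [i0]
    between [rho j + d] and [sigma j + d], and only those before [l] add to the
    mass. *)
Lemma card_moved l N d i0 rho sigma y (phi : {ffun IJ * 'I_N -> F} -> IJ -> nat -> F)
    (E : {set {ffun IJ * 'I_N -> F}}) : (l <= N)%N ->
  (forall x, x \in E -> agree l (phi x) y) ->
  (forall x i j p, x \in E ->
     ~~ [&& i == i0, rho j + d <= p & p < sigma j + d]%N ->
     phi x (i, j) p = extend x (i, j) p) ->
  (#|E| <= #|F| ^ (m * n * (N - l)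
    + \sum_j (minn l (sigma j + d) - minn l (rho j + d))))%N.
Proof.
move=> lN Ey Ephi; have F0 : (0 < #|F|)%N by apply/card_gt0P; exists 0.
pose D (u : IJ) (p : nat) := (u.1 == i0) &&
  (minn l (rho u.2 + d) <= p < minn l (sigma u.2 + d))%N.
pose P u p := (l <= p)%N || D u p.
have cE : (#|E| <= #|F| ^ (\sum_(u : IJ) \sum_(p < N) P u p))%N.
  apply: card_determined => x x' xE x'E agP.
  apply: extend_inj => -[i j] p pN.
  have [/agP|] := boolP (P (i, j) p); first exact.
  rewrite /P /D negb_or -ltnNge => /andP[pl nD].
  have nD' : ~~ [&& i == i0, rho j + d <= p & p < sigma j + d]%N.
    by move: nD => /=; case: eqP => //= _; lia.
  by rewrite -(Ephi x)// -(Ephi x')// (Ey x xE)// (Ey x' x'E).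
apply: leq_trans cE _; rewrite leq_pexp2l//.
rewrite -sum_cylinder -[X in (_ <= _ + X)%N](_ : \sum_(u : IJ) \sum_(p < N) D u p = _)%N.
  rewrite -big_split /=; apply: leq_sum => u _.
  rewrite -big_split /=; apply: leq_sum => p _; rewrite /P.
  by case: (l <= p)%N; case: (D _ _).
apply: (@sum_row_interval N i0 (fun j => minn l (rho j + d))
  (fun j => minn l (sigma j + d))) => j.
exact: leq_trans (geq_minl _ _) lN.
Qed.

Lemma card_cylinder b N y : (b <= N)%N -> (#|F| ^ (m * n * (N - b))
  <= #|[set x : {ffun IJ * 'I_N -> F} | `[< agree b (extend x) y >]]|)%N.
Proof.
move=> bN; pose Fr := [set u : IJ * 'I_N | (b <= u.2)%N].
have <- : #|Fr| = (m * n * (N - b))%N.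
  rewrite -sum_cylinder pair_bigA /= -sum1_card big_mkcond /=.
  by apply: eq_bigr => u _; rewrite inE; case: (_ <= _)%N.
rewrite -[#|F|](_ : #|[in @predT F]| = _)%N; last by apply: eq_card.
rewrite -(card_pffun_on (0 : F) [in Fr] [in predT]).
pose f (w : {ffun IJ * 'I_N -> F}) := [ffun u => if u \in Fr then w u else y u.1 u.2].
rewrite -(@card_in_imset _ _ f (pffun_on (0 : F) [in Fr] [in predT])); last first.
  have z (v : {ffun IJ * 'I_N -> F}) u : v \in pffun_on (0 : F) [in Fr] [in predT] ->
      u \notin Fr -> v u = 0.
    case/pfamilyP => /supportP vs _ uFr; exact: vs.
  move=> w w' wP w'P /ffunP fw; apply/ffunP => u.
  have := fw u; rewrite !ffunE; case: ifPn => // uFr _.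
  by rewrite (z w u wP uFr) (z w' u w'P uFr).
apply: subset_leq_card; apply/fintype.subsetP => _ /imsetP[w _ ->].
rewrite inE; apply/asboolP => i p pb; have pN := leq_trans pb bN.
by rewrite -[p]/(val (Ordinal pN)) extend_ord ffunE inE /= leqNgt pb.
Qed.

(** Minkowski's theorem on linear forms: there are more coefficient vectors
    than vectors of values, and two coefficient vectors with the same values
    have the required difference. *)
Lemma pairing_dirichlet K rho a : (\sum_j rho j < m * K)%N ->
  exists x : {ffun 'I_m * 'I_K -> F}, x != [ffun=> 0] /\
    forall j l, (l < rho j)%N -> pairing K.-1 (extend x) (column a j) l = 0.
Proof.
move=> rhoK; pose L := (\sum_j rho j)%N.
pose f (x : {ffun 'I_m * 'I_K -> F}) : {ffun 'I_n * 'I_L -> F} :=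
  [ffun u : 'I_n * 'I_L => if (u.2 < rho u.1)%N then
     pairing K.-1 (extend x) (column a u.1) u.2 else 0].
have rhoL j : (rho j <= L)%N by rewrite /L (bigD1 j)//= leq_addr.
have cf : (#|f @: [set: {ffun 'I_m * 'I_K -> F}]| <= #|F| ^ L)%N.
  have LE : L = (\sum_j \sum_(p < L) (0 <= p < rho j))%N.
    by apply: eq_bigr => j _; rewrite sum_interval ?subn0.
  rewrite [X in (_ <= _ ^ X)%N]LE.
  apply: (card_determined (P := fun j p => (0 <= p < rho j)%N)).
  move=> _ _ /imsetP[x _ ->] /imsetP[x' _ ->] agP.
  apply/ffunP => -[j p]; have [pr|rp] := ltnP p (rho j); last first.
    by rewrite !ffunE /= ltnNge rp.
  by have := agP j p (ltn_ord p) pr; rewrite !extend_ord.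
have /negP ninj : ~~ injectiveb f.
  apply/negP => /injectiveP finj; move: cf.
  rewrite card_imset// cardsT card_ffun card_prod !card_ord.
  by rewrite leq_exp2l ?card_finNzRing_gt1// leqNgt rhoK.
have [x [x' [xx' fxx']]] : exists x x', x != x' /\ f x = f x'.
  apply: contrapT => h; apply: ninj; apply/injectiveP => x x' fxx'.
  by apply/eqP/negPn/negP => xx'; apply: h; exists x, x'.
exists (x - x'); split; first by rewrite subr_eq0.
move=> j l lr; have lL : (l < L)%N by exact: leq_trans (rhoL j).
have /ffunP/(_ (j, Ordinal lL)) := fxx'; rewrite !ffunE /= lr => /eqP.
rewrite -subr_eq0 -pairingB_coef => /eqP <-; apply: eq_pairing => // i e _.
have [eK|Ke] := ltnP e K; last by rewrite !extend_ge// subrr.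
by rewrite -[e]/(val (Ordinal eK)) !extend_ord !ffunE.
Qed.

(** The degree is also bounded below because forms of degree less than [b] are
    partly decided by the prefix of length [b], and have to be counted
    separately. *)
Definition approximable (L dmin b N : nat) rho y :=
  [set x : {ffun IJ * 'I_N -> F} | `[< agree b (extend x) y /\
     exists (q : {ffun 'I_m * 'I_L -> F}) (i0 : 'I_m) (d : nat),
       [/\ (dmin <= d < L)%N, pivot (extend q) i0 d &
         forall j l, (l < rho j)%N ->
           pairing d (extend q) (column (extend x) j) l = 0] >]].

(** Union bound over the [#|F| ^ (m * L)] coefficient vectors. *)
Lemma card_approximable L dmin b N rho y : (forall j, rho j + L <= N.+1)%N ->
  (#|approximable L dmin b N rho y| * #|F| ^ (\sum_j (rho j - (b - dmin)))
   <= #|F| ^ (m * L + m * n * (N - b)))%N.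
Proof.
move=> rhoN; have F0 : (0 < #|F|)%N by apply/card_gt0P; exists 0.
pose Q (q : {ffun 'I_m * 'I_L -> F}) (x : {ffun IJ * 'I_N -> F}) := agree b (extend x) y /\
  exists (i0 : 'I_m) (d : nat),
       [/\ (dmin <= d < L)%N, pivot (extend q) i0 d &
         forall j l, (l < rho j)%N ->
           pairing d (extend q) (column (extend x) j) l = 0].
pose E (q : {ffun 'I_m * 'I_L -> F}) := [set x : {ffun IJ * 'I_N -> F} | `[< Q q x >]].
have cE q : (#|E q| * #|F| ^ (\sum_j (rho j - (b - dmin)))
    <= #|F| ^ (m * n * (N - b)))%N.
  have [->|/set0Pn[x]] := eqVneq (E q) finset.set0.
    by rewrite cards0 mul0n.
  rewrite inE => /asboolP[_ [i0 [d [/andP[dd dL] qpiv _]]]].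
  apply: leq_trans (@card_solutions b N d _ i0 rho y (E q) qpiv _ _ _).
  - rewrite leq_mul2l leq_pexp2l ?orbT//.
    by apply: leq_sum => j _; lia.
  - by move=> j; have := rhoN j; lia.
  - by move=> x'; rewrite inE => /asboolP[].
  - move=> x' j l; rewrite inE => /asboolP[_ [i1 [d' [_ [qd' q0'] h]]]] /h.
    have [qd q0] := qpiv.
    suff -> : d' = d by [].
    have [dd'|d'd|//] := ltngtP d' d.
      by move: qd; rewrite (q0' _ _ dd') eqxx.
    by move: qd'; rewrite (q0 _ _ d'd) eqxx.
have sub : approximable L dmin b N rho y \subset \bigcup_q E q.
  apply/fintype.subsetP => x; rewrite inE => /asboolP[ag [q [i0 [d h]]]].
  apply/bigcupP; exists q => //; rewrite inE; apply/asboolP.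
  by split=> //; exists i0, d.
have cU : (#|\bigcup_q E q| <= \sum_q #|E q|)%N.
  apply: (big_ind2 (fun (A : {set {ffun IJ * 'I_N -> F}}) k => #|A| <= k)%N) => //.
    by rewrite cards0.
  move=> A k B k' Ak Bk'; apply: leq_trans (leq_card_setU A B).1 _.
  exact: leq_add.
apply: leq_trans (leq_mul (leq_trans (subset_leq_card sub) cU) (leqnn _)) _.
rewrite big_distrl /=; apply: leq_trans (leq_sum _ (fun q _ => cE q)) _.
by rewrite sum_nat_const card_ffun card_prod !card_ord expnD.
Qed.

(** The forms of low degree are too few to serve many points. Those of degree
    less than [b] and those of degree between [b] and [K] are solutions of the
    pigeonhole principle for at most a quarter of the cylinder each. The width
    [n + 3] of the window of degrees makes up for the rounding of the [rho j],
    whose sum may fall short of [m * (K + n + 3)] by [n]. *)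
Lemma many_good b K N rho y : (0 < m)%N ->
  (m * b + n * b + n + 2 <= K)%N -> (b <= N)%N ->
  (forall j, rho j + (K + n + 3) <= N.+1)%N ->
  (\sum_j rho j < m * (K + n + 3) <= \sum_j rho j + n)%N ->
  exists G : {set {ffun IJ * 'I_N -> F}},
    (#|F| ^ (m * n * (N - b)) <= 2 * #|G|)%N /\
    forall x, x \in G -> agree b (extend x) y /\
      exists c i0 d, [/\ (K < d < K + n + 3)%N, pivot c i0 d &
        forall j l, (l < rho j)%N -> pairing d c (column (extend x) j) l = 0].
Proof.
move=> m0 bK bN rhoN /andP[rhoK Krho]; have bK' : (b <= K)%N by nia.
have F0 : (0 < #|F|)%N by apply/card_gt0P; exists 0.
have F2 : (2 <= #|F|)%N by exact: card_finNzRing_gt1.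
pose B := [set x : {ffun IJ * 'I_N -> F} | `[< agree b (extend x) y >]].
pose B1 := approximable b 0 b N rho y.
pose B2 := approximable K.+1 b b N rho y.
pose T := (#|F| ^ (m * n * (N - b)))%N.
have quarter L dmin : (forall j, rho j + L <= N.+1)%N ->
    (m * L + 2 <= \sum_j (rho j - (b - dmin)))%N ->
    (4 * #|approximable L dmin b N rho y| <= T)%N.
  move=> hL hS; have := card_approximable dmin b y hL.
  rewrite expnD => h.
  have mL0 : (0 < #|F| ^ (m * L))%N by rewrite expn_gt0 F0.
  rewrite -(leq_pmul2l mL0); apply: leq_trans h.
  rewrite (mulnC 4%N) mulnCA leq_mul2l; apply/orP; right.
  apply: leq_trans (leq_pexp2l F0 hS).
  by rewrite expnD leq_mul2l (leq_sqr 2) F2 orbT.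
have q1 : (4 * #|B1| <= T)%N.
  apply: quarter; first by move=> j; have := rhoN j; lia.
  have : (\sum_j rho j <= \sum_(j < n) (rho j - (b - 0)) + n * b)%N.
    rewrite -[X in (_ + X)%N](_ : \sum_(j < n) b = _)%N; last first.
      by rewrite sum_nat_const card_ord.
    by rewrite -big_split /=; apply: leq_sum => j _; lia.
  have := leq_pmull (K + n + 3) m0; move: Krho bK.
  by move: (\sum_j rho j)%N (\sum_(j < n) _)%N (m * (K + n + 3))%N; lia.
have q2 : (4 * #|B2| <= T)%N.
  apply: quarter; first by move=> j; have := rhoN j; lia.
  rewrite subnn; under eq_bigr => j _ do rewrite subn0.
  have := leq_pmull (n + 2) m0; move: Krho.
  by rewrite mulnS !mulnDr; lia.
exists (B :\: (B1 :|: B2)); split.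
  rewrite -/T; move: q1 q2 (card_cylinder y bN); rewrite -/T -/B.
  have := cardsID (B1 :|: B2) B; have := (leq_card_setU B1 B2).1.
  have := subset_leq_card (finset.subsetIr B (B1 :|: B2)).
  rewrite -/B1 -/B2; clearbody T.
  by move: #|_| #|_| #|_| #|_| #|_| => a1 a2 a3 a4 a5; lia.
move=> x; rewrite finset.in_setD finset.in_setU negb_or => /andP[/andP[nB1 nB2]].
rewrite inE => /asboolP xB; split=> //.
have [q [q0 qx]] := @pairing_dirichlet (K + n + 3) rho (extend x) rhoK.
have [i0 [d [dK piv]]] := pivot_ex q0; have [piv0 piv1] := piv.
have qx' j l : (l < rho j)%N -> pairing d (extend q) (column (extend x) j) l = 0.
  by move=> /qx; rewrite (pairing_widen (d := d))//; lia.
exists (extend q), i0, d; split => //; rewrite dK andbT ltnNge; apply/negP => dleK.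
have shrink L : (d < L)%N ->
    [/\ pivot (extend (truncate L (extend q))) i0 d & forall j l, (l < rho j)%N ->
      pairing d (extend (truncate L (extend q))) (column (extend x) j) l = 0].
  move=> dL; split.
    split; first by rewrite extend_truncate.
    move=> i e de; have [eL|Le] := ltnP e L; last by rewrite extend_ge.
    by rewrite extend_truncate// piv1.
  move=> j l lr; rewrite -(qx' j l lr); apply: eq_pairing => // i e ed.
  by rewrite extend_truncate//; lia.
have [db|bd] := ltnP d b.
  move/negP: nB1; apply; rewrite inE; apply/asboolP; split=> //.
  have [h1 h2] := shrink b db.
  by exists (truncate b (extend q)), i0, d; split.
move/negP: nB2; apply; rewrite inE; apply/asboolP; split=> //.
have [h1 h2] := shrink K.+1 dleK.
by exists (truncate K.+1 (extend q)), i0, d; split => //; rewrite bd.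
Qed.

End Counting.

(** * The dimension function *)

Section Exponent.
Variables (R : realType) (m n : nat) (tau : 'I_n -> R).

(** With [u = tau j] this is the numerator of the fraction in
    [dim_exponent m tau j]. For vectors of degree about [K], and beyond the
    common height of [waterfill], it gives the mass of a cylinder of length
    [K * u] in the lower bound: the pivot row contributes to its exponent of
    decay the amount [K * profile u], up to bounded errors. *)
Definition profile (u : R) : R :=
  n%:R + m%:R + \sum_(r < n) Num.max 0 (u - tau r).

Lemma dim_exponentE j : dim_exponent m tau j
  = n%:R * (m%:R - 1) + profile (tau j) / tau j.
Proof.
rewrite /dim_exponent /profile; congr (_ + _ / _).
rewrite (addrC n%:R); congr (_ + _); rewrite -sumrN big_mkcond /=.
apply: eq_bigr => r _; rewrite opprB; case: ltP => h.
  by rewrite max_r// subr_ge0 ltW.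
by rewrite max_l// subr_le0.
Qed.

(** The slope of [profile] at [u] is the number of the [tau r] below [u]. If it
    is at least [v], the inequality at the largest [tau r] below [u] propagates
    up to [u]; otherwise the one at the smallest [tau r] above [u] propagates
    down to [u], and there is one since [v <= n]. *)
Lemma profile_ge (v : R) : 0 < v -> v <= n%:R ->
  (forall j, v * tau j <= profile (tau j)) ->
  forall u, v * u <= profile u.
Proof.
move=> v0 vn vtau u.
pose cnt : R := \sum_(r < n) (tau r <= u)%R%:R.
have sumcnt (w : R) : \sum_(r < n) (tau r <= u)%R%:R * w = cnt * w.
  by rewrite -mulr_suml.
have [vc|cv] := leP v cnt.
  have [p0 p0u] : exists p, tau p <= u.
    apply: contrapT => /forallNP h; have c0 : cnt = 0.
      by rewrite /cnt big1// => r _; case: (boolP (tau r <= u)) => // /h.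
    by move: vc; rewrite c0 leNgt v0.
  case: (@arg_maxP _ _ _ p0 (fun p => tau p <= u) tau p0u) => p pu pmax.
  have -> : profile u = profile (tau p) + cnt * (u - tau p).
    rewrite /profile -sumcnt -[RHS]addrA; congr (_ + _); rewrite -big_split /=.
    apply: eq_bigr => r _; case: (leP (tau r) u) => ru.
      by have rp := pmax r ru; rewrite mul1r !max_r ?subr_ge0//; ring.
    by rewrite mul0r addr0 !max_l// subr_le0 ?ltW// (le_lt_trans pu).
  have := vtau p; have : v * (u - tau p) <= cnt * (u - tau p).
    by rewrite ler_wpM2r// subr_ge0.
  by lra.
have [q0 q0u] : exists q, u < tau q.
  apply: contrapT => /forallNP h; have cn : cnt = n%:R.
    rewrite /cnt -[n in RHS]card_ord -sum1_card natr_sum.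
    by apply: eq_bigr => r _; case: (leP (tau r) u) => // /h.
  by move: cv; rewrite cn ltNge vn.
case: (@arg_minP _ _ _ q0 (fun q => u < tau q) tau q0u) => q qu qmin.
have : profile (tau q) = profile u + cnt * (tau q - u).
  rewrite /profile -sumcnt -[RHS]addrA; congr (_ + _); rewrite -big_split /=.
  apply: eq_bigr => r _; case: (leP (tau r) u) => ru.
    by rewrite mul1r !max_r ?subr_ge0// ?(le_trans ru (ltW qu))//; ring.
  have rq := qmin r ru.
  by rewrite mul0r addr0 !max_l ?subr_le0// ltW.
have := vtau q; have : cnt * (tau q - u) <= v * (tau q - u).
  by apply: ler_wpM2r; rewrite ?subr_ge0 ltW.
by lra.
Qed.

(** The pigeonhole principle can only make about [K] digits vanish in total.
    Sharing them by cutting the targets [sigma j] at a common height is the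
    choice that gives the optimal dimension. *)
Lemma waterfill (K : nat) (sigma : 'I_n -> nat) :
  (0 < K)%N -> (K <= \sum_j sigma j)%N ->
  exists g, (\sum_j minn (sigma j) g < K <= \sum_j minn (sigma j) g + n)%N.
Proof.
move=> K0 Ks.
have ex : exists g, (K <= \sum_j minn (sigma j) g)%N.
  exists (\sum_j sigma j)%N; apply: leq_trans Ks _; apply: leq_sum => j _.
  by rewrite leq_min leqnn /= (bigD1 j)//= leq_addr.
case: (ex_minnP ex) => -[|g] Kg gmin.
  by move: Kg; rewrite big1 => [|j _]; [lia | rewrite minn0].
exists g; rewrite ltnNge; apply/andP; split.
  by apply/negP => /gmin; rewrite ltnn.
apply: leq_trans Kg _; rewrite -[X in (_ + X)%N](_ : \sum_(j < n) 1 = _)%N.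
  by rewrite -big_split /=; apply: leq_sum => j _; lia.
by rewrite sum1_card card_ord.
Qed.

(** The left-hand side counts the digits before [l] that are forgotten when the
    levels [minn (sigma j) g + K] are pushed to [sigma j + K]. None are
    forgotten up to the common height [g + K]; beyond it their number is
    [n * l - K * profile (l / K)], up to rounding. *)
Lemma profile_defect (v : R) (K l g : nat) (sigma : 'I_n -> nat) :
  0 < v -> v <= n%:R -> (forall j, v * tau j <= profile (tau j)) ->
  (0 < K)%N -> (forall j, tau j * K%:R <= (sigma j + K)%:R <= tau j * K%:R + 1) ->
  (m * K <= \sum_j minn (sigma j) g + n)%N ->
  (\sum_j (minn l (sigma j + K) - minn l (minn (sigma j) g + K)))%:R
    <= n%:R * l%:R - v * l%:R + 2 * n%:R :> R.
Proof.
move=> v0 vn vtau K0 sigmaK rhoK.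
have [lg|gl] := leqP l (g + K).
  rewrite big1; last by move=> j _; lia.
  have := ler_wpM2r (ler0n R l) vn; have := ler0n R n; lra.
have K0' : 0 < K%:R :> R by rewrite ltr0n.
have := profile_ge v0 vn vtau (l%:R / K%:R).
rewrite mulrA ler_pdivrMr// => hl.
have hs : \sum_(r < n) Num.max 0 (l%:R / K%:R - tau r) * K%:R
   <= \sum_(r < n) (1 + l%:R - (minn l (sigma r + K))%:R).
  apply: ler_sum => r _.
  have /andP[s1 s2] := sigmaK r.
  rewrite (maxr_pMl _ _ (ltW K0')) mul0r mulrBl divfK ?(gt_eqF K0')// ge_max.
  have [lS|Sl] := leqP l (sigma r + K).
    have := s2; have : l%:R <= (sigma r + K)%:R :> R by rewrite ler_nat.
    by rewrite natrD; lra.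
  have : (sigma r + K)%:R <= l%:R :> R by rewrite ler_nat ltnW.
  by move=> h; apply/andP; split; lra.
have hd : (\sum_j (minn l (sigma j + K) - minn l (minn (sigma j) g + K)))%:R
   = \sum_(j < n) (minn l (sigma j + K))%:R - \sum_(j < n) (minn (sigma j) g + K)%:R :> R.
  rewrite natr_sum -sumrB; apply: eq_bigr => j _.
  have -> : minn l (minn (sigma j) g + K) = (minn (sigma j) g + K)%N by lia.
  by rewrite natrB//; lia.
have hr : m%:R * K%:R + n%:R * K%:R <= \sum_(j < n) (minn (sigma j) g + K)%:R + n%:R :> R.
  rewrite -natr_sum -!natrM -!natrD ler_nat big_split /= sum_nat_const card_ord.
  by move: rhoK; set S := (\sum_(i < n) _)%N; lia.
move: hs; rewrite sumrB big_split /= !sumr_const card_ord => hs.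
rewrite hd; move: hl; rewrite /profile mulrDl mulrDl => hl.
rewrite -[l%:R *+ n]mulr_natl in hs.
rewrite -mulr_suml in hs; move: hs hl hr.
lra.
Qed.

End Exponent.

(** * Concentrating the uniform measure on approximable points *)

Section Concentration.
Variables (R : realType) (F : finFieldType) (m n : nat) (tau : 'I_n -> R).
Local Notation IJ := ('I_m * 'I_n)%type.
Local Notation t := (#|F|%:R : R).
Implicit Types (a y : IJ -> nat -> F).

Lemma pairing_adjust d c i0 (rho sigma : 'I_n -> nat) a : pivot c i0 d ->
  (forall j l, (l < rho j)%N -> pairing d c (column a j) l = 0) ->
  exists a', (forall j l, (l < sigma j)%N -> pairing d c (column a' j) l = 0) /\
    forall i j p, ~~ [&& i == i0, rho j + d <= p & p < sigma j + d]%N ->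
      a' (i, j) p = a (i, j) p.
Proof.
move=> piv ha.
have /choice[f hf] j := pairing_solve (column a j) (rho j) (sigma j) piv.
exists (fun u => f u.2 u.1); split=> [j l ls|i j p h]; last by case: (hf j) => _ ->.
have [fj fa] := hf j.
have [lr|rl] := ltnP l (rho j); last by rewrite -(fj l) ?rl.
rewrite -(ha j l lr); apply: eq_pairing => // i p pl; apply: fa.
by rewrite !negb_and -!ltnNge; apply/orP; right; apply/orP; left; lia.
Qed.

(** The same polynomials serve the whole cylinder, so that the approximation
    survives the passage to the limit point of nested cylinders. *)
Definition approx_on (D N : nat) a := forall a', agree N a a' ->
  exists c i0 d, [/\ (D < d)%N, pivot c i0 d & forall j l,
    l%:R < (tau j - 1) * d%:R -> pairing d c (column a' j) l = 0].

(** Union bound over the [m] pivot rows and the [n + 2] possible degrees. No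
    digit before [K] is moved, which is why the first case has no loss; in the
    second one [n * (n + 3)] pays for the degree being known up to [n + 3]
    only. *)
Lemma card_good_moved b K N g (sigma : 'I_n -> nat)
    (phi : {ffun IJ * 'I_N -> F} -> IJ -> nat -> F)
    (piv : {ffun IJ * 'I_N -> F} -> 'I_m * nat) (G : {set {ffun IJ * 'I_N -> F}}) :
  (b <= N)%N -> (#|F| ^ (m * n * (N - b)) <= 2 * #|G|)%N ->
  (forall x, x \in G -> (K < (piv x).2 < K + n + 3)%N) ->
  (forall x i j p, x \in G ->
     ~~ [&& i == (piv x).1, minn (sigma j) g + (piv x).2 <= p
         & p < sigma j + (piv x).2]%N ->
     phi x (i, j) p = extend x (i, j) p) ->
  forall l y, (b <= l <= N)%N -> forall e,
  ((if (l <= K)%N then 0 else \sum_j (minn l (sigma j + (K + n + 3))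
      - minn l (minn (sigma j) g + (K + n + 3))) + n * (n + 3)) + e
   <= m * n * (l - b))%N ->
  (#|[set x in G | `[< agree l (phi x) y >]]| * #|F| ^ e
    <= 2 * (m * (n + 2)) * #|G|)%N.
Proof.
move=> bN Gbig pivK phiE l y /andP[bl lN] e he.
have F0 : (0 < #|F|)%N by apply/card_gt0P; exists 0.
set A := [set x in G | _].
pose E (u : 'I_m * 'I_(n + 2)) := [set x in A | piv x == (u.1, K.+1 + u.2)%N].
have cE u : (#|E u| * #|F| ^ e <= #|F| ^ (m * n * (N - b)))%N.
  pose d := (K.+1 + u.2)%N; have u2 := ltn_ord u.2.
  have h : (#|E u| <= #|F| ^ (m * n * (N - l) + \sum_j (minn l (sigma j + d)
      - minn l (minn (sigma j) g + d))))%N.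
    apply: (@card_moved F m n l N d u.1 (fun j => minn (sigma j) g) sigma y phi) => //.
      by move=> x; rewrite !inE => /andP[/andP[_ /asboolP]].
    move=> x i j p; rewrite !inE => /andP[/andP[xG _] /eqP xu] hp.
    by apply: phiE; rewrite // xu.
  apply: leq_trans (leq_mul h (leqnn _)) _; rewrite -expnD leq_pexp2l//.
  have -> : (m * n * (N - b) = m * n * (N - l) + m * n * (l - b))%N.
    by rewrite -mulnDr; congr (_ * _)%N; lia.
  rewrite -addnA leq_add2l; apply: leq_trans he; rewrite leq_add2r.
  have [lK|Kl] := leqP l K.
    by rewrite big1// => j _; rewrite /d; lia.
  rewrite -[X in (_ <= _ + X)%N](_ : \sum_(j < n) (n + 3) = _)%N; last first.
    by rewrite sum_nat_const card_ord.
  by rewrite -big_split /=; apply: leq_sum => j _; rewrite /d; lia.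
have sub : A \subset \bigcup_u E u.
  apply/fintype.subsetP => x xA; have xG : x \in G by move: xA; rewrite inE => /andP[].
  have /andP[Kd dK] := pivK x xG.
  have dn : ((piv x).2 - K.+1 < n + 2)%N by lia.
  apply/bigcupP; exists ((piv x).1, Ordinal dn) => //.
  rewrite inE xA /=; apply/eqP; rewrite [LHS]surjective_pairing; congr pair; lia.
have cU : (#|\bigcup_u E u| <= \sum_u #|E u|)%N.
  apply: (big_ind2 (fun (A : {set {ffun IJ * 'I_N -> F}}) k => #|A| <= k)%N) => //.
    by rewrite cards0.
  move=> A1 k A2 k' Ak Bk'; apply: leq_trans (leq_card_setU A1 A2).1 _.
  exact: leq_add.
apply: leq_trans (leq_mul (leq_trans (subset_leq_card sub) cU) (leqnn _)) _.
rewrite big_distrl /=; apply: leq_trans (leq_sum _ (fun q _ => cE q)) _.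
rewrite sum_nat_const card_prod !card_ord.
rewrite (mulnC 2%N) -[leqRHS]mulnA leq_mul2l; apply/orP; right.
exact: Gbig.
Qed.

Hypothesis m0 : (0 < m)%N.
Hypothesis tau_gt1 : forall j, 1 < tau j.
Hypothesis tau_sum : n%:R + m%:R <= \sum_(j < n) tau j.
Variable v : R.
Hypothesis v0 : 0 < v.
Hypothesis vn : v <= n%:R.
Hypothesis vtau : forall j, v * tau j <= profile m tau (tau j).

Let smin := n%:R * (m%:R - 1) + v.

(** The measure-theoretic core: the images [phi x] of the uniform measure on
    [G] satisfy a Frostman condition of exponent [s] at all lengths between
    [b] and [N]. The constant is independent of [b], and it disappears at the
    final length [N], so that the construction can be iterated without loss:
    the gap between [s] and [smin] absorbs any constant once [K] is large. *)
Lemma concentrate s b D y : 0 <= s -> s < smin ->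
  exists N (G : {set {ffun IJ * 'I_N -> F}})
    (phi : {ffun IJ * 'I_N -> F} -> IJ -> nat -> F),
  [/\ (b < N)%N, (0 < #|G|)%N,
    forall x, x \in G -> agree b (phi x) y /\ approx_on D N (phi x),
    forall l z, (b <= l <= N)%N -> #|[set x in G | `[< agree l (phi x) z >]]|%:R
      * t `^ (s * (l%:R - b%:R)) <= (2 * (m * (n + 2)))%:R * #|G|%:R &
    forall z, #|[set x in G | `[< agree N (phi x) z >]]|%:R
      * t `^ (s * (N%:R - b%:R)) <= #|G|%:R].
Proof.
move=> s0 ssm.
have F2 : (2 <= #|F|)%N by exact: card_finNzRing_gt1.
have F0 : (0 < #|F|)%N by lia.
have t1 : 1 < t by exact: card_gt1.
have t0 : 0 < t by exact: lt_trans t1.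
pose L := (2 * (m * (n + 2)))%N.
have L0 : 0 < L%:R :> R by rewrite ltr0n /L; nia.
(* All losses beyond the depth [K]: the prefix of length [b], the rounding of
   the levels, the window of degrees, and the constant [L <= t ^ L]. *)
pose C : R := m%:R * n%:R * b%:R + 2 * n%:R + n%:R * (n%:R + 3) + L%:R.
have sm0 : 0 < smin - s by rewrite subr_gt0.
have [K [CK DK bK]] : exists K, [/\ C <= (smin - s) * K%:R, (D <= K)%N
    & (m * b + n * b + n + 2 <= K)%N].
  have [T hT] : exists T : nat, C / (smin - s) < T%:R.
    by exists (Num.truncn (C / (smin - s))).+1; exact: truncnS_gt.
  exists (T + (D + (m * b + n * b + n + 2)))%N; split; last 2 first.
  - by rewrite addnCA leq_addr.
  - by rewrite addnA leq_addl.
  rewrite mulrC -ler_pdivrMr//; apply: ltW; apply: lt_le_trans hT _.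
  by rewrite ler_nat leq_addr.
have bK' : (b <= K)%N by clear -bK m0; nia.
pose Kt := (K + n + 3)%N; have Kt0 : (0 < Kt)%N by rewrite /Kt addn3.
have KKt : (K < Kt)%N by clear; rewrite /Kt; lia.
have [sigma hsigma] : exists sigma : 'I_n -> nat, forall j,
    (tau j - 1) * Kt%:R < (sigma j)%:R <= (tau j - 1) * Kt%:R + 1.
  exists (fun j => (Num.truncn ((tau j - 1) * Kt%:R)).+1) => j.
  rewrite truncnS_gt /= -natr1 lerD2r truncn_le mulr_ge0//.
  by rewrite subr_ge0 ltW.
have sigma_gt j : (tau j - 1) * Kt%:R < (sigma j)%:R by case/andP: (hsigma j).
have sigma_le j : (sigma j)%:R <= (tau j - 1) * Kt%:R + 1 by case/andP: (hsigma j).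
have sigma_sum : (m * Kt <= \sum_j sigma j)%N.
  rewrite -(ler_nat R) natrM natr_sum.
  apply: le_trans (ler_sum _ (fun j _ => ltW (sigma_gt j))).
  rewrite -mulr_suml ler_wpM2r// ?ler0n// sumrB sumr_const card_ord.
  by rewrite lerBrDl.
have mKt0 : (0 < m * Kt)%N by rewrite muln_gt0 m0.
have [g /andP[g1 g2]] := waterfill mKt0 sigma_sum.
have [N sigmaN KN] : exists2 N, forall j, (sigma j + Kt <= N)%N & (Kt <= N)%N.
  exists (Kt + \sum_j sigma j)%N; last exact: leq_addr.
  by move=> j; rewrite addnC leq_add2l (bigD1 j)//= leq_addr.
have bN : (b < N)%N by apply: leq_ltn_trans bK' _; exact: leq_trans KN.
have [G [Gbig hG]] : exists G : {set {ffun IJ * 'I_N -> F}},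
    (#|F| ^ (m * n * (N - b)) <= 2 * #|G|)%N /\
    forall x, x \in G -> agree b (extend x) y /\
      exists c i0 d, [/\ (K < d < Kt)%N, pivot c i0 d &
        forall j l, (l < minn (sigma j) g)%N -> pairing d c (column (extend x) j) l = 0].
  apply: many_good => //; [exact: ltnW| |by rewrite g1].
  by move=> j; apply: leq_trans (leqW (sigmaN j)); rewrite leq_add2r geq_minl.
have /choice[w hw] : forall x : {ffun IJ * 'I_N -> F},
    exists w : ('I_m -> nat -> F) * ('I_m * nat) * (IJ -> nat -> F),
    x \in G -> [/\ (K < w.1.2.2 < Kt)%N, pivot w.1.1 w.1.2.1 w.1.2.2,
      forall j l, (l < sigma j)%N -> pairing w.1.2.2 w.1.1 (column w.2 j) l = 0 &
      forall i j p, ~~ [&& i == w.1.2.1, minn (sigma j) g + w.1.2.2 <= p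
        & p < sigma j + w.1.2.2]%N -> w.2 (i, j) p = extend x (i, j) p].
  move=> x; have [xG|] := boolP (x \in G); last first.
    by exists (fun _ _ => 0, (Ordinal m0, 0%N), extend x).
  have [_ [c [i0 [d [dK piv /(pairing_adjust sigma piv)[a' [h1 h2]]]]]]] := hG x xG.
  by exists (c, (i0, d), a').
pose phi x := (w x).2; exists N, G, phi.
have cnt := card_good_moved (ltnW bN) Gbig (phi := phi)
  (piv := fun x => (w x).1.2) (g := g) (sigma := sigma) (K := K).
have {}cnt l z e : (b <= l <= N)%N ->
    ((if (l <= K)%N then 0 else \sum_j (minn l (sigma j + Kt)
        - minn l (minn (sigma j) g + Kt)) + n * (n + 3)) + e
     <= m * n * (l - b))%N ->
    (#|[set x in G | `[< agree l (phi x) z >]]| * #|F| ^ e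
    <= L * #|G|)%N.
  move=> lb he; apply: cnt lb _ he; first by move=> x /hw[].
  by move=> x i j p /hw[_ _ _]; apply.
(* Beyond the depth [K] the gap between [s] and [smin] even pays for [L]. *)
have deep l z : (K < l <= N)%N -> #|[set x in G | `[< agree l (phi x) z >]]|%:R
      * t `^ (s * (l%:R - b%:R)) <= #|G|%:R.
  move=> /andP[Kl lN].
  have dfct := @profile_defect R m n tau v Kt l g sigma v0 vn vtau Kt0.
  pose dl := (\sum_j (minn l (sigma j + Kt) - minn l (minn (sigma j) g + Kt)))%N.
  have {}dfct : dl%:R <= n%:R * l%:R - v * l%:R + 2 * n%:R :> R.
    apply: dfct => // j; rewrite natrD.
    move: (sigma_gt j) (sigma_le j); rewrite mulrBl mul1r.
    by move: ((sigma j)%:R) (Kt%:R) (tau j * _) => a1 a2 a3; lra.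
  have lb : (b <= l)%N by exact: leq_trans bK' (ltnW Kl).
  have key : (dl + n * (n + 3))%:R + s * (l%:R - b%:R) + L%:R <= (m * n * (l - b))%:R :> R.
    rewrite (natrD _ dl) (natrM _ n) (natrD _ n) 2!(natrM _ _ (l - b), natrM _ m n) natrB//.
    have Kl' : K%:R <= l%:R :> R by rewrite ler_nat ltnW.
    have h1 : C <= (smin - s) * l%:R.
      by apply: le_trans CK _; rewrite ler_wpM2l// ltW.
    have h2 : 0 <= s * b%:R by rewrite mulr_ge0.
    move: h1; rewrite /C /smin; move: dfct h2.
    move: (l%:R) (b%:R) (n%:R) (m%:R) (L%:R) (dl%:R) => l' b' n' m' L' d'.
    by lra.
  have lbR : 0 <= s * (l%:R - b%:R) by rewrite mulr_ge0// subr_ge0 ler_nat.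
  have dle : (dl + n * (n + 3) <= m * n * (l - b))%N.
    rewrite -(ler_nat R); apply: le_trans key; rewrite -addrA lerDl.
    exact: addr_ge0 lbR (ltW L0).
  pose e := (m * n * (l - b) - (dl + n * (n + 3)))%N.
  have eE : e%:R = (m * n * (l - b))%:R - (dl + n * (n + 3))%:R :> R by rewrite natrB.
  have := @cnt l z e; rewrite (ltn_geF Kl) lb lN -/dl subnKC// => /(_ isT (leqnn _)).
  rewrite -(ler_nat R) (natrM _ #|_|) (natrM _ L) natrX => h.
  rewrite -(ler_pM2l L0); apply: le_trans h.
  rewrite mulrCA ler_wpM2l//.
  rewrite -powR_mulrn ?(ltW t0)//.
  have LtL : L%:R <= t `^ L%:R.
    rewrite powR_mulrn ?(ltW t0)// -natrX ler_nat.
    by apply: ltnW; apply: ltn_expl.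
  apply: le_trans (ler_wpM2r (powR_ge0 _ _) LtL) _.
  rewrite -powRD; last by rewrite (gt_eqF t0) /= implybT.
  by rewrite ler_powR ?(ltW t1)// eE lerBrDl (addrC L%:R) addrA.
split=> //.
- rewrite lt0n; apply/eqP => G0; move: Gbig; rewrite G0 muln0 leqn0 expn_eq0.
  by rewrite gtn_eqF.
- move=> x xG; have [hb _] := hG x xG; have [dK piv h1 h2] := hw x xG; split.
    move=> [i j] p pb; rewrite -(hb _ _ pb); apply: h2.
    rewrite !negb_and -!ltnNge; apply/orP; right; apply/orP; left.
    by move: dK pb bK' => /andP[]; clear; lia.
  move=> a' ag; exists (w x).1.1, (w x).1.2.1, (w x).1.2.2; split => //.
    by case/andP: dK => Kd _; exact: leq_ltn_trans Kd.
  move=> j l lj; have lS : (l < sigma j)%N.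
    rewrite -(ltr_nat R); apply: lt_trans lj _; apply: le_lt_trans (sigma_gt j).
    rewrite ler_wpM2l ?subr_ge0 ?(ltW (tau_gt1 j))// ler_nat ltnW//; by case/andP: dK.
  rewrite -(h1 j l lS); apply: eq_pairing => // i p pl; rewrite /column.
  apply/esym/ag; move: dK lS pl (sigmaN j) => /andP[]; clear; lia.
- move=> l z /andP[bl lN]; have [lK|Kl] := leqP l K; last first.
    apply: le_trans (deep l z _) _; first by rewrite Kl.
    by rewrite ler_peMl// ler1n -(ltr_nat R).
  have := @cnt l z (m * n * (l - b))%N; rewrite lK bl lN add0n => /(_ isT (leqnn _)).
  rewrite -(ler_nat R) (natrM _ #|_|) (natrM _ L) natrX; apply: le_trans; rewrite ler_wpM2l//.
  rewrite -powR_mulrn ?(ltW t0)// ler_powR ?(ltW t1)// !natrM natrB// ler_wpM2r//.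
    by rewrite subr_ge0 ler_nat.
  by move: ssm vn; rewrite /smin; move: (n%:R) (m%:R) => n' m'; lra.
- by move=> z; apply: deep; rewrite leqnn andbT; exact: leq_trans KN.
Qed.

End Concentration.

(** * Avoiding a cheap family of cylinders *)

Section Avoidance.
Variables (R : realType) (F : finFieldType) (m n : nat) (tau : 'I_n -> R).
Local Notation IJ := ('I_m * 'I_n)%type.
Local Notation t := (#|F|%:R : R).
Implicit Types (a : IJ -> nat -> F).

Hypothesis m0 : (0 < m)%N.
Hypothesis tau_gt1 : forall j, 1 < tau j.
Hypothesis tau_sum : n%:R + m%:R <= \sum_(j < n) tau j.
Variable v : R.
Hypothesis v0 : 0 < v.
Hypothesis vn : v <= n%:R.
Hypothesis vtau : forall j, v * tau j <= profile m tau (tau j).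

Variable s : R.
Hypothesis s0 : 0 <= s.
Hypothesis sv : s < n%:R * (m%:R - 1) + v.

(** The cylinders to be avoided have centers [y i] and lengths [l i]. *)
Variables (y : nat -> IJ -> nat -> F) (l : nat -> nat).

Let K0 : R := (2 * (m * (n + 2)))%:R.
Let cost i := t `^ (- (s * (l i)%:R)).
Let inside b a (i : nat) := (b < l i)%N && `[< agree b a (y i) >].

(** The invariant of the construction. The constant [K0] is that of the
    Frostman condition in [concentrate]. *)
Definition safe b a := (forall i, (l i <= b)%N -> ~ agree (l i) a (y i)) /\
  forall M, K0 * \sum_(i < M | inside b a i) cost i < t `^ (- (s * b%:R)).

Let t0 : 0 < t. Proof. exact: lt_trans (card_gt1 R F). Qed.
Let K0_ge1 : 1 <= K0. Proof. by rewrite ler1n !muln_gt0 m0 addn2. Qed.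
Let K0_ge0 : 0 <= K0. Proof. exact: le_trans K0_ge1. Qed.

Let powD x z : t `^ (x + z) = t `^ x * t `^ z.
Proof. by rewrite powRD// (gt_eqF t0) /= implybT. Qed.

Let powN x : t `^ (- x) * t `^ x = 1.
Proof. by rewrite -powD addNr powRr0. Qed.

(** If no [phi x] were safe, each [x] in [G] would be charged at least 1 by the
    forbidden cylinders inside the current one: 1 for each cylinder that
    contains that of [phi x], and the relative cost for each smaller one. On
    average over [G], the cylinder [i] charges at most
    [K0 * t ^ (- s * (l i - b))] by the Frostman condition, and these charges
    sum to less than 1 because the current cylinder is safe. *)
Lemma safe_step b a D : safe b a -> exists p : nat * (IJ -> nat -> F),
  [/\ (b < p.1)%N, agree b a p.2, approx_on tau D p.1 p.2 & safe p.1 p.2].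
Proof.
move=> [out cheap].
have [N [G [phi [bN G0 hG hl hN]]]] :=
  concentrate m0 tau_gt1 tau_sum v0 vn vtau b D a s0 sv.
apply: contrapT => /forallNP none.
pose ag k x i : R := (`[< agree k (phi x) (y i) >])%:R.
pose f x i := if (l i <= N)%N then ag (l i) x i
  else K0 * t `^ (s * N%:R) * cost i * ag N x i.
have f0 x i : 0 <= f x i.
  by rewrite /f; case: ifP => // _; rewrite !mulr_ge0 ?powR_ge0.
have ins x i k : x \in G -> (b <= k)%N -> (b < l i)%N ->
    agree k (phi x) (y i) -> inside b a i.
  move=> /hG[agx _] bk bl agk; rewrite /inside bl /=; apply/asboolP.
  exact: agree_trans (agree_sym agx) (agreeW bk agk).
have bad x : exists M, x \in G -> 1 <= \sum_(i < M | inside b a i) f x i.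
  have [xG|xG] := boolP (x \in G); last by exists 0%N.
  have [agx apx] := hG x xG.
  have /not_andP[/existsNP[i /not_implyP[lN /contrapT agi]]|/existsNP[M /negP]] :
      ~ safe N (phi x).
    by move=> sx; apply: (none (N, phi x)); split=> //; exact: agree_sym.
  - exists i.+1 => _.
    have bl : (b < l i)%N.
      rewrite ltnNge; apply/negP => lb; apply: (out i lb).
      exact: agree_trans (agreeW lb (agree_sym agx)) agi.
    have bi : inside b a i := ins x i (l i) xG (ltnW bl) bl agi.
    rewrite big_mkcond big_ord_recr /= bi.
    rewrite {2}/f lN /ag asboolT// lerDr.
    by apply: sumr_ge0 => k _; case: ifP.
  - rewrite -leNgt => h; exists M => _.
    have {h} : 1 <= K0 * t `^ (s * N%:R) * \sum_(i < M | inside N (phi x) i) cost i.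
      by rewrite -[leLHS](powN (s * N%:R)) mulrAC ler_wpM2r ?powR_ge0.
    move=> /le_trans; apply; rewrite mulr_sumr big_mkcond [leRHS]big_mkcond /=.
    apply: ler_sum => i _; case: (boolP (inside N (phi x) i)) => [|_]; last by case: ifP.
    move=> /andP[Nl /asboolP agN].
    rewrite (ins x i N xG (ltnW bN) (ltn_trans bN Nl) agN).
    by rewrite /f leqNgt Nl /= /ag asboolT// mulr1.
have /choice[Mx hMx] := bad.
pose M := (\sum_x Mx x)%N.
have {bad}bad x : x \in G -> 1 <= \sum_(i < M | inside b a i) f x i.
  move=> xG; apply: le_trans (hMx x xG) _.
  have MM : (Mx x <= M)%N by rewrite /M (bigD1 x)//= leq_addr.
  rewrite -!(big_mkord (inside b a) (f x)) [leRHS](big_cat_nat (n := Mx x))//=.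
  by rewrite lerDl; apply: sumr_ge0.
have : (#|G|%:R : R) <= \sum_(x in G) \sum_(i < M | inside b a i) f x i.
  by rewrite -sum1_card natr_sum; exact: ler_sum.
rewrite exchange_big /= leNgt => /negP; apply.
have card_ag k i : \sum_(x in G) ag k x i = #|[set x in G | `[< agree k (phi x) (y i) >]]|%:R.
  rewrite -sum1_card natr_sum; under [RHS]eq_bigl => x do rewrite inE.
  rewrite big_mkcondr /=; apply: eq_bigr => x _; rewrite /ag.
  by case: ifP.
apply: (@le_lt_trans _ _ (\sum_(i < M | inside b a i)
    K0 * #|G|%:R * t `^ (s * b%:R) * cost i)); last first.
  rewrite -mulr_sumr; move: (cheap M); set S := \sum_(i < M | _) _ => KS.
  have -> : K0 * #|G|%:R * t `^ (s * b%:R) * S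
      = #|G|%:R * (K0 * S * t `^ (s * b%:R)) by ring.
  by rewrite gtr_pMr ?ltr0n// -[ltRHS](powN (s * b%:R)) ltr_pM2r ?powR_gt0.
apply: ler_sum => i /andP[bl _]; rewrite /f; have [lN|Nl] := leqP (l i) N.
  rewrite card_ag; have := hl (l i) (y i); rewrite (ltnW bl) lN => /(_ isT) h.
  rewrite -(ler_pM2r (powR_gt0 (s * ((l i)%:R - b%:R)) t0)).
  apply: le_trans h _; rewrite -mulrA /cost -!mulrA -!powD.
  have -> : s * b%:R + (- (s * (l i)%:R) + s * ((l i)%:R - b%:R)) = 0 by ring.
  by rewrite powRr0 mulr1.
rewrite -mulr_sumr card_ag; have h := hN (y i).
rewrite -(ler_pM2r (powR_gt0 (s * (N%:R - b%:R)) t0)) -[leLHS]mulrA.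
apply: le_trans (ler_wpM2l _ h) _; first by rewrite !mulr_ge0 ?powR_ge0.
rewrite [leLHS](_ : _ = K0 * #|G|%:R * (t `^ (s * N%:R) * cost i)); last by ring.
rewrite -!mulrA ler_wpM2l// ler_wpM2l// /cost -!powD.
by rewrite [X in _ <= _ `^ X](_ : _ = s * N%:R - s * (l i)%:R)//; ring.
Qed.

(** Nested safe cylinders shrink to a point. It lies in no forbidden cylinder
    because a cylinder of length at least [l i] that is safe misses the
    [i]-th one altogether. *)
Lemma avoidance : (forall M, K0 * \sum_(i < M) cost i < 1) ->
  exists a, (forall i, ~ agree (l i) a (y i)) /\
  forall D, exists c i0 d, [/\ (D < d)%N, pivot c i0 d & forall j k,
    k%:R < (tau j - 1) * d%:R -> pairing d c (column a j) k = 0].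
Proof.
move=> small.
have l_gt0 i : (0 < l i)%N.
  rewrite lt0n; apply/eqP => li0; have := small i.+1; rewrite ltNge => /negP; apply.
  rewrite big_ord_recr /= {2}/cost li0 mulr0 oppr0 powRr0 mulrDr mulr1.
  apply: le_trans K0_ge1 _; rewrite lerDr mulr_ge0//.
  by apply: sumr_ge0 => k _; exact: powR_ge0.
pose a0 : IJ -> nat -> F := fun _ _ => 0.
have safe0 : safe 0 a0.
  split=> [i|M]; first by rewrite leqNgt l_gt0.
  rewrite mulr0 oppr0 powRr0; apply: le_lt_trans (small M).
  rewrite ler_wpM2l// big_mkcond; apply: ler_sum => i _.
  by case: ifP => // _; exact: powR_ge0.
have /choice[next hnext] : forall z : (nat * (IJ -> nat -> F)) * nat,
    exists p : nat * (IJ -> nat -> F), safe z.1.1 z.1.2 ->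
    [/\ (z.1.1 < p.1)%N, agree z.1.1 z.1.2 p.2, approx_on tau z.2 p.1 p.2
      & safe p.1 p.2].
  move=> [[b a] D]; have [/(safe_step D)[p hp]|ns] := pselect (safe b a).
    by exists p.
  by exists (0%N, a0).
pose fix st k := if k is k'.+1 then next (st k', k') else (0%N, a0).
have st_safe k : safe (st k).1 (st k).2.
  by elim: k => [//|k IH] /=; have [] := hnext (st k, k) IH.
have st_next k := hnext (st k, k) (st_safe k).
have st_ge k : (k <= (st k).1)%N.
  elim: k => // k IH; have [/= h _ _ _] := st_next k.
  exact: leq_ltn_trans IH h.
have st_agree k k' : (k <= k')%N ->
    ((st k).1 <= (st k').1)%N /\ agree (st k).1 (st k).2 (st k').2.
  move=> kk'; rewrite -(subnKC kk'); elim: (k' - k)%N => [|e [IH1 IH2]].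
    by rewrite addn0.
  rewrite addnS; have [/= h1 h2 _ _] := st_next (k + e)%N; split.
    exact: leq_trans IH1 (ltnW h1).
  exact: agree_trans IH2 (agreeW IH1 h2).
pose a i p := (st p.+1).2 i p.
have aP k : agree (st k).1 (st k).2 a.
  move=> i p pk; rewrite /a; have [kp|pk'] := leqP k p.+1.
    by have [_] := st_agree _ _ kp; apply.
  by have [_ h] := st_agree _ _ (ltnW pk'); rewrite h// st_ge.
exists a; split=> [i agi|D].
  have [out _] := st_safe (l i); apply: (out i (st_ge _)).
  exact: agree_trans (agreeW (st_ge _) (aP (l i))) agi.
by have [_ _ h _] := st_next D; apply: h; exact: (aP D.+1).
Qed.

End Avoidance.

(** * Digits of matrices of Laurent series *)

Lemma gt1_ltr_powR (R : realType) (z : R) : 1 < z ->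
  {homo powR z : x y / x < y}.
Proof.
move=> z1 x y xy; have z0 : 0 < z by exact: lt_trans z1.
by rewrite /powR (gt_eqF z0) ltr_expR ltr_pM2r// ln_gt0.
Qed.

Section Translation.
Variables (R : realType) (F : finFieldType).
Local Notation t := (#|F|%:R : R).
Local Notation lnorm := (@lnorm R F).
Implicit Types (x y : laurent F).

Let t1 : 1 < t. Proof. exact: card_gt1. Qed.
Let t0 : 0 < t. Proof. exact: lt_trans t1. Qed.

Lemma lnorm_ge_coef x (k : int) : x k != 0 -> t ^ k <= lnorm x.
Proof.
move=> xk; have x0 : x != 0 by apply: contraNneq xk => ->.
rewrite /Defs.lnorm (negPf x0) ler_eXz2l//.
have [_ h] := ldegP x0; rewrite leNgt; apply/negP => /h /eqP.
exact/negP.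
Qed.

Lemma lnorm_lt_coef x (z : R) : 0 < z ->
  (forall k, x k != 0 -> t ^ k < z) -> lnorm x < z.
Proof.
move=> z0 h; rewrite /Defs.lnorm; case: eqVneq => // x0.
by apply: h; have [] := ldegP x0.
Qed.

Lemma lnorm_lt1P x : lnorm x < 1 <-> forall k : int, 0 <= k -> x k = 0.
Proof.
split=> [x1 k k0|h]; last first.
  apply: lnorm_lt_coef => // k xk; rewrite -[ltRHS](expr0z t) ltr_eXz2l//.
  by rewrite ltNge; apply/negP => /h /eqP; exact/negP.
apply/eqP/negPn/negP => /lnorm_ge_coef xk.
have := le_lt_trans xk x1; rewrite -[ltRHS](expr0z t) ltr_eXz2l//.
by rewrite ltNge k0.
Qed.

Lemma exprz_Negz (l : nat) : t ^ (Negz l) = t `^ (- l.+1%:R).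
Proof. by rewrite -powR_intmul ?(ltW t0)// NegzE mulrNz. Qed.

Lemma ldist_small y (z : R) :
  (forall l : nat, l%:R < z -> y (Negz l) = 0) -> ldist R y < t `^ (- z).
Proof.
move=> h; have [N yN] := laurentP y.
pose p := \poly_(i < (absz N).+1) y i%:Z.
apply: (le_lt_trans (ldist_le R y p)); apply: lnorm_lt_coef; first exact: powR_gt0.
case=> [k|l] /=.
  rewrite coef_poly; case: ltnP => Nk; first by rewrite subrr eqxx.
  by rewrite yN ?subr0 ?eqxx//; lia.
rewrite subr0 => yl; rewrite exprz_Negz; apply: gt1_ltr_powR => //.
rewrite ltrN2 -natr1 ltr_pwDr// leNgt; apply/negP => /h /eqP; exact/negP.
Qed.

Lemma ldist_small_digit y (z : R) (l : nat) :
  ldist R y < t `^ (- z) -> l.+1%:R <= z -> y (Negz l) = 0.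
Proof.
have [p ->] := ldistP R y => yz lz; apply/eqP/negPn/negP => yl.
have /lnorm_ge_coef : (y - lpoly p) (Negz l) != 0 by rewrite /= subr0.
rewrite exprz_Negz leNgt (lt_le_trans yz)// ler_powR ?(ltW t1)//.
by rewrite lerN2.
Qed.

Lemma coef_lpolyM (p : {poly F}) x d l : (size p <= d.+1)%N ->
  (lpoly p * x) (Negz l) = \sum_(e < d.+1) p`_e * x (Negz (l + e)).
Proof.
move=> pd; change (Defs.conv (lpoly p) x (Negz l) = \sum_(e < d.+1) p`_e * x (Negz (l + e))).
rewrite /Defs.conv (fsbigE [seq e%:Z | e <- iota 0 d.+1]).
- rewrite -(big_mkord xpredT (fun e => p`_e * x (Negz (l + e)))).
  rewrite big_map /index_iota subn0.
  apply: congr_big => // e; first by rewrite in_setT.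
  by move=> _; congr (_ * x _); lia.
- by rewrite map_inj_uniq ?iota_uniq// => i j [].
- by [].
- move=> i _ /mapP id.
  case: i id => e id; last by rewrite /= mul0r.
  rewrite [lpoly p _]/= nth_default ?mul0r// leqNgt; apply/negP => ep; apply: id.
  by exists e => //; rewrite mem_iota add0n; exact: leq_trans ep pd.
Qed.

Variables (m n : nat).
Local Notation IJ := ('I_m * 'I_n)%type.
Implicit Types (A B : 'M[laurent F]_(m, n)) (a : IJ -> nat -> F).

(** [Negz p] is [- (p + 1)]: the coefficients at nonnegative exponents, zero
    on the unit ball, are dropped. *)
Definition digits A : IJ -> nat -> F := fun u p => A u.1 u.2 (Negz p).

Lemma of_digits_subproof (f : nat -> F) :
  exists N : int, forall k, N < k -> (if k is Negz p then f p else 0) = 0.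
Proof. by exists (-1); case. Qed.

Definition of_digits a : 'M[laurent F]_(m, n) :=
  \matrix_(i, j) Laurent (of_digits_subproof (a (i, j))).

Lemma of_digitsK a : digits (of_digits a) = a.
Proof. by apply/funext => -[i j]; apply/funext => p; rewrite /digits mxE. Qed.

Lemma of_digits_unit a : @unit_ball R F m n (of_digits a).
Proof. by move=> i j; apply/lnorm_lt1P => -[p|p]//; rewrite mxE. Qed.

Lemma agree_mxdist l A B : @unit_ball R F m n A -> @unit_ball R F m n B ->
  agree l (digits A) (digits B) -> mxdist R A B <= t `^ (- l.+1%:R).
Proof.
move=> uA uB ag; apply/bigmax_leP; split=> [|i _]; first exact: powR_ge0.
apply/bigmax_leP; split=> [|j _]; first exact: powR_ge0.
rewrite -exprz_Negz; apply/lnorm_leP; case=> [k _|p] /=.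
  have h C : @unit_ball R F m n C -> C i j k = 0.
    by move=> uC; have [-> //] := lnorm_lt1P (C i j); exact: uC.
  by rewrite !h// subrr.
by move=> lp; rewrite [A i j _](ag (i, j) p) ?subrr//; lia.
Qed.

Lemma mxdist_agree l A B : mxdist R A B <= t `^ (- l.+1%:R) ->
  agree l (digits A) (digits B).
Proof.
move=> AB [i j] p pl; rewrite /digits /=; apply/eqP; rewrite -subr_eq0.
have : lnorm (A i j - B i j) <= t ^ (Negz l).
  rewrite exprz_Negz; apply: le_trans AB.
  apply: le_trans (le_bigmax _ _ i); exact: (le_bigmax _ _ j).
by move=> /lnorm_leP /(_ (Negz p)) /= ->//; lia.
Qed.

Lemma form_digit (q : 'rV[{poly F}]_m) A j d l :
  (forall i, (size (q ord0 i) <= d.+1)%N) ->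
  ((map_mx (@lpoly F) q *m col j A) ord0 ord0) (Negz l)
  = pairing d (fun i e => (q ord0 i)`_e) (column (digits A) j) l.
Proof.
move=> qd; rewrite mxE /pairing.
rewrite (_ : lcoef (\sum_k _) _ = \sum_(i < m) (lpoly (q ord0 i) * A i j) (Negz l)).
  by apply: eq_bigr => i _; rewrite (coef_lpolyM _ _ (qd i)).
rewrite (eq_bigr (fun i => lpoly (q ord0 i) * A i j)); last first.
  by move=> i _; rewrite !mxE.
by elim/big_rec2 : _ => // i z w _ <-.
Qed.

Lemma vnorm_pivot (q : 'rV[{poly F}]_m) i0 d :
  pivot (fun i e => (q ord0 i)`_e) i0 d ->
  vnorm R (map_mx (@lpoly F) q) = t `^ d%:R.
Proof.
move=> [qd q0]; rewrite powR_mulrn ?(ltW t0)//.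
apply/eqP; rewrite eq_le; apply/andP; split; last first.
  apply: le_trans (le_bigmax _ _ i0); rewrite mxE.
  by rewrite -[t ^+ d]/(t ^ (Posz d)); apply: lnorm_ge_coef.
apply/bigmax_leP; split=> [|i _]; first by rewrite exprn_ge0// ltW.
rewrite mxE -[t ^+ d]/(t ^ (Posz d)); apply/lnorm_leP; case=> //= k dk.
exact: q0.
Qed.

Lemma W_bound (z : R) (d : nat) :
  (t `^ d%:R) `^ (- z) * t `^ d%:R = t `^ (- ((z - 1) * d%:R)).
Proof.
rewrite -powRrM -powRD; last by rewrite (gt_eqF t0) /= implybT.
by congr (_ `^ _); ring.
Qed.

Variable tau : 'I_n -> R.

(** The two translations of membership in [W] differ by one in the number of
    digits, since [ldist] takes discrete values and the bound is real. *)
Lemma W_digits A : @unit_ball R F m n A ->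
  (forall D, exists c i0 d, [/\ (D < d)%N, pivot c i0 d & forall j l,
    l%:R < (tau j - 1) * d%:R -> pairing d c (column (digits A) j) l = 0]) ->
  @W R F m n tau A.
Proof.
move=> uA h; split=> // /finite_seqP[s sE].
pose D := (\max_(q <- s) \max_(i < m) size (q ord0 i))%N.
have [c [i0 [d [Dd piv hc]]]] := h D; have [c0 cd] := piv.
pose q : 'rV[{poly F}]_m := \row_i \poly_(e < d.+1) c i e.
have qE i e : (q ord0 i)`_e = c i e.
  by rewrite mxE coef_poly ltnS; case: leqP => // /cd ->.
have qpiv : pivot (fun i e => (q ord0 i)`_e) i0 d.
  by split=> [|i e /cd]; rewrite qE.
have : [set` s]%classic q.
  rewrite -sE => j /=; rewrite (vnorm_pivot qpiv) W_bound.
  apply: ldist_small => l lj; rewrite (@form_digit q A j d l).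
    by rewrite -[RHS](hc j l lj); apply: eq_pairing => // i e _; rewrite qE.
  by move=> i; rewrite mxE; exact: size_poly.
move=> /= qs; have : (size (q ord0 i0) <= D)%N.
  apply: leq_trans (leq_bigmax_seq _ qs isT).
  exact: (leq_bigmax (F := fun i => size (q ord0 i))).
rewrite leqNgt => /negP; apply; apply: (leq_trans Dd).
rewrite ltnW// ltnNge; apply/negP => /(nth_default 0).
by rewrite qE => /eqP; exact/negP.
Qed.

(** Only finitely many polynomial vectors have degree less than [D]. *)
Lemma digits_W A : @W R F m n tau A -> forall D, exists c i0 d,
  [/\ (D <= d)%N, pivot c i0 d & forall j l,
    l.+1%:R <= (tau j - 1) * d%:R -> pairing d c (column (digits A) j) l = 0].
Proof.
move=> [uA infq] D.
have [q qW [i qi]] : exists2 q : 'rV[{poly F}]_m, (forall j : 'I_n,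
      let q' := map_mx (@lpoly F) q in
      ldist R ((q' *m col j A) 0 0) < vnorm R q' `^ (- tau j) * vnorm R q') &
    exists i, (D < size (q ord0 i))%N.
  apply: contrapT => none; apply: infq.
  pose g (M : 'M[F]_(m, D)) : 'rV[{poly F}]_m := \row_i rVpoly (row i M).
  apply: (@sub_finite_set _ _ (g @` setT)%classic); last exact: finite_image.
  move=> q /= hq; exists (\matrix_(i, e) (q ord0 i)`_e) => //.
  apply/rowP => i; rewrite mxE; apply/polyP => e; rewrite coef_rVpoly.
  case: insubP => [u _ <-|]; first by rewrite !mxE.
  rewrite -leqNgt => De; rewrite nth_default//; apply: leq_trans De.
  by rewrite leqNgt; apply/negP => qi; apply: none; exists q => //; exists i.
case: (@arg_maxnP _ i xpredT (fun i => size (q ord0 i)) isT) => i0 _ imax.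
have qi0 : (D < size (q ord0 i0))%N by exact: leq_trans (imax i isT).
pose d := (size (q ord0 i0)).-1.
have dE : d.+1 = size (q ord0 i0) by rewrite /d prednK//; exact: leq_trans qi0.
have qpiv : pivot (fun i e => (q ord0 i)`_e) i0 d.
  split; first by rewrite -/(lead_coef _) lead_coef_eq0 -size_poly_gt0 -dE.
  by move=> k e de; apply: nth_default; apply: leq_trans (imax k isT) _; rewrite /= -dE.
exists (fun i e => (q ord0 i)`_e), i0, d; split=> //; first by rewrite -ltnS dE.
move=> j l lj; have := qW j; rewrite /= (vnorm_pivot qpiv) W_bound => hj.
rewrite -form_digit; last by move=> k; rewrite dE; exact: imax.
exact: ldist_small_digit hj lj.
Qed.

End Translation.

Local Open Scope classical_set_scope.
Local Open Scope ring_scope.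

(** * The lower bound *)

Section Diameter.
Variables (R : realType) (T : Type) (d : T -> T -> R).
Implicit Types U : set T.

Lemma diam_ge0 U : (0 <= diam d U)%E.
Proof. by apply: ereal_sup_ubound; left. Qed.

Lemma diam_ub U p q : U p -> U q -> ((d p q)%:E <= diam d U)%E.
Proof. by move=> Up Uq; apply: ereal_sup_ubound; right; exists (p, q). Qed.

Lemma diam_le U (r : R) : 0 <= r -> (forall p q, U p -> U q -> d p q <= r) ->
  (diam d U <= r%:E)%E.
Proof.
move=> r0 h; apply: ge_ereal_sup => _ [->|[[p q] [Up Uq] <-]].
  by rewrite lee_fin.
by rewrite lee_fin; exact: h.
Qed.

Lemma hcost_ge0 s U : (0 <= hcost d s U)%E.
Proof. by rewrite /hcost; case: ifP => // _; exact: poweR_ge0. Qed.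

Lemma hpremeasure_ge0 s delta A : (0 <= hpremeasure d s delta A)%E.
Proof.
apply: le_ereal_inf_tmp => _ [U _ <-]; apply: nneseries_ge0 => k _ _.
exact: hcost_ge0.
Qed.

End Diameter.

Section LowerBound.
Variables (R : realType) (F : finFieldType) (T : Type) (dist : T -> T -> R).
Local Notation t := (#|F|%:R : R).

Let t1 : 1 < t. Proof. exact: card_gt1. Qed.
Let t0 : 0 < t. Proof. exact: lt_trans t1. Qed.

Lemma powR_small (s z : R) : 0 < s -> 0 < z -> exists l : nat, t `^ (- (s * l%:R)) < z.
Proof.
move=> s0 z0; have lt0 : 0 < ln t by rewrite ln_gt0.
have [l hl] : exists l : nat, z^-1 / (s * ln t) < l%:R.
  by exists (Num.truncn (z^-1 / (s * ln t))).+1; exact: truncnS_gt.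
exists l; rewrite powRN invf_plt ?posrE ?powR_gt0//.
rewrite /powR (gt_eqF t0); apply: lt_le_trans (expR_ge1Dx _).
rewrite ltr_pdivrMr ?mulr_gt0// in hl.
apply: lt_le_trans hl _.
by rewrite (_ : s * l%:R * ln t = l%:R * (s * ln t)) ?lerDr//; ring.
Qed.

(** Sets can be traded for cylinders: [l] is the largest length compatible with
    the diameter, which costs the factor [t ^ (2 * s)]. A set of diameter 0 has
    no largest length, and [e] pays for it. This trade requires a positive
    exponent, hence the passage from [s'], possibly 0, to [s]. *)
Lemma cylinder_length (s s' e : R) (U : set T) : 0 < s -> 0 <= s' <= s -> 0 < e ->
  (diam dist U <= (t `^ (- 1))%:E)%E ->
  exists l : nat, (diam dist U <= (t `^ (- l.+1%:R))%:E)%E /\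
    t `^ (- (s * l%:R)) <= t `^ (2 * s) * fine (hcost dist s' U) + e.
Proof.
move=> s0 /andP[s'0 s's] e0 Ud.
have powle x y : x <= y -> t `^ x <= t `^ y by move=> xy; rewrite ler_powR ?(ltW t1).
have c0 : 0 <= t `^ (2 * s) * fine (hcost dist s' U).
  by rewrite mulr_ge0 ?powR_ge0// fine_ge0// hcost_ge0.
have dfin : diam dist U \is a fin_num.
  rewrite ge0_fin_numE ?diam_ge0//; exact: le_lt_trans Ud (ltry _).
have [r dE] : exists r, diam dist U = r%:E.
  by exists (fine (diam dist U)); rewrite fineK.
have : 0 <= r by rewrite -lee_fin -dE diam_ge0.
rewrite dE le_eqVlt => /orP[/eqP <-|r0].
  have [l hl] := powR_small s0 e0; exists l; split; first by rewrite lee_fin powR_ge0.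
  by apply: le_trans (ltW hl) _; rewrite lerDr.
have r1 : r <= t `^ (- 1) by rewrite -lee_fin -dE.
have ex : exists l : nat, t `^ (- l.+2%:R) < r.
  have [l hl] := powR_small ltr01 r0; exists l; apply: le_lt_trans hl.
  by apply: powle; rewrite mul1r lerN2 ler_nat; exact: leqW (leqnSn l).
case: (ex_minnP ex) => l hl lmin; exists l; split.
  rewrite lee_fin; case: l lmin {hl} => // l lmin; rewrite leNgt; apply/negP => /lmin.
  by rewrite ltnn.
have -> : fine (hcost dist s' U) = r `^ s'.
  rewrite /hcost; case: ifPn => [/eqP U0|_].
    suff : (r%:E <= 0)%E by rewrite lee_fin leNgt r0.
    rewrite -dE U0; apply: ge_ereal_sup => _ [->//|[[p q] [[]]]].
  by rewrite dE poweR_EFin.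
apply: (@le_trans _ _ (t `^ (2 * s) * r `^ s')); last by rewrite lerDl ltW.
apply: (@le_trans _ _ (t `^ (2 * s) * r `^ s)); last first.
  rewrite ler_wpM2l ?powR_ge0// ger_powR// r0 /=; apply: le_trans r1 _.
  by rewrite -[leRHS](powRr0 t); apply: powle; rewrite oppr_le0.
have -> : - (s * l%:R) = 2 * s + (- l.+2%:R) * s by rewrite -!natr1; ring.
rewrite powRD ?(gt_eqF t0) /= ?implybT// ler_wpM2l ?powR_ge0// powRrM.
by rewrite ge0_ler_powR ?nnegrE ?powR_ge0 ?(ltW s0) ?(ltW r0) ?(ltW hl).
Qed.

End LowerBound.

Section MassTransference.
Variables (R : realType) (F : finFieldType) (m n : nat) (tau : 'I_n -> R).
Local Notation t := (#|F|%:R : R).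
Hypothesis m0 : (0 < m)%N.
Hypothesis tau_gt1 : forall j, 1 < tau j.
Hypothesis tau_sum : n%:R + m%:R <= \sum_(j < n) tau j.

Let t1 : 1 < t. Proof. exact: card_gt1. Qed.
Let t0 : 0 < t. Proof. exact: lt_trans t1. Qed.

Lemma sum_pow_half (M : nat) : \sum_(i < M) (2^-1 : R) ^+ i.+1 < 1.
Proof.
have -> : \sum_(i < M) (2^-1 : R) ^+ i.+1 = 1 - 2^-1 ^+ M.
  elim: M => [|M IH]; first by rewrite big_ord0 expr0 subrr.
  by rewrite big_ord_recr /= IH exprS; field.
by rewrite gtrBl exprn_gt0// invr_gt0.
Qed.

(** A cover of cost less than [eps] would turn into a family of cylinders cheap
    enough to be avoided by a point of [W]. Half of the budget [1 / K0] is
    spent on the sets of diameter 0. *)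
Lemma hmeasure_W_neq0 (v s' : R) : 0 < v -> v <= n%:R ->
  (forall j, v * tau j <= profile m tau (tau j)) ->
  0 <= s' -> s' < n%:R * (m%:R - 1) + v ->
  hmeasure (@mxdist R F m n) s' (@W R F m n tau) <> 0%E.
Proof.
move=> v0 vn vtau s'0 s'v H0.
pose s := (s' + (n%:R * (m%:R - 1) + v)) / 2.
have s's : s' < s by rewrite /s; lra.
have sv : s < n%:R * (m%:R - 1) + v by rewrite /s; lra.
have s0 : 0 < s by exact: le_lt_trans s's.
pose K0 : R := (2 * (m * (n + 2)))%:R.
have K0_gt0 : 0 < K0 by rewrite ltr0n !muln_gt0 m0 addn2.
pose eps := t `^ (- (2 * s)) / (2 * K0).
have eps0 : 0 < eps by rewrite divr_gt0 ?powR_gt0// mulr_gt0.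
have pre0 : (hpremeasure (@mxdist R F m n) s' (t `^ (- 1)) (@W R F m n tau) < eps%:E)%E.
  apply: (@le_lt_trans _ _ 0%E); last by rewrite lte_fin.
  rewrite -H0; apply: ereal_sup_ubound; exists (t `^ (- 1)) => //=.
  by rewrite powR_gt0.
have [_ [U [Ucov Udiam] <-] Ucost] := ereal_inf_lt pre0.
have /choice[l hl] : forall i, exists l : nat,
    (diam (@mxdist R F m n) (U i) <= (t `^ (- l.+1%:R))%:E)%E /\
    t `^ (- (s * l%:R)) <= t `^ (2 * s) * fine (hcost (@mxdist R F m n) s' (U i))
      + (2 * K0)^-1 * 2^-1 ^+ i.+1.
  move=> i; apply: cylinder_length => //; first by rewrite s'0 ltW.
  by rewrite mulr_gt0 ?invr_gt0 ?mulr_gt0 ?exprn_gt0 ?invr_gt0.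
have /choice[y hy] : forall i, exists A, (@unit_ball R F m n `&` U i) !=set0 ->
    (@unit_ball R F m n `&` U i) A.
  move=> i; have [[A hA]|none] := pselect ((@unit_ball R F m n `&` U i) !=set0).
    by exists A.
  by exists 0.
have small M : K0 * \sum_(i < M) t `^ (- (s * (l i)%:R)) < 1.
  pose c i := fine (hcost (@mxdist R F m n) s' (U i)).
  have cE i : hcost (@mxdist R F m n) s' (U i) = (c i)%:E.
    rewrite /c fineK// ge0_fin_numE ?hcost_ge0// /hcost; case: ifP => _.
      exact: ltry.
    by apply: poweR_lty; exact: le_lt_trans (Udiam i) (ltry _).
  have cM : \sum_(i < M) c i < eps.
    rewrite -lte_fin -sumEFin; apply: le_lt_trans Ucost.
    under eq_bigr => i _ do rewrite -cE.
    rewrite -(big_mkord xpredT (fun i => hcost (@mxdist R F m n) s' (U i))).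
    by apply: nneseries_lim_ge => k _ _; exact: hcost_ge0.
  apply: (@le_lt_trans _ _ (K0 * (t `^ (2 * s) * \sum_(i < M) c i
      + (2 * K0)^-1 * \sum_(i < M) 2^-1 ^+ i.+1))).
    rewrite ler_wpM2l ?(ltW K0_gt0)// !mulr_sumr -big_split /=.
    by apply: ler_sum => i _; have [] := hl i.
  apply: (@lt_le_trans _ _ (K0 * (t `^ (2 * s) * eps + (2 * K0)^-1 * 1))).
    rewrite ltr_pM2l// ltrD// ltr_pM2l ?powR_gt0 ?invr_gt0 ?mulr_gt0//.
    exact: sum_pow_half.
  rewrite /eps mulrA -powRD ?(gt_eqF t0) /= ?implybT// subrr powRr0.
  have half (k : R) : 0 < k -> k * ((2 * k)^-1 + (2 * k)^-1) = 1.
    by move=> k0; field; rewrite gt_eqF.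
  by rewrite mul1r mulr1 half.
have [a [out approx]] := avoidance m0 tau_gt1 tau_sum v0 vn vtau (ltW s0) sv
  (fun i => digits (y i)) small.
have aW : @W R F m n tau (of_digits a).
  by apply: W_digits; rewrite ?of_digitsK//; exact: of_digits_unit.
have [i _ Ui] := Ucov _ aW.
have [uy Uy] : (@unit_ball R F m n `&` U i) (y i).
  by apply: hy; exists (of_digits a); split=> //; exact: of_digits_unit.
apply: (out i); rewrite -[a]of_digitsK; apply: (@mxdist_agree R).
by rewrite -lee_fin; apply: le_trans (diam_ub _ Ui Uy) _; have [] := hl i.
Qed.

Lemma hdim_W_ge (i0 : 'I_n) :
  (forall j, dim_exponent m tau i0 <= dim_exponent m tau j) ->
  ((dim_exponent m tau i0)%:E <= hdim (@mxdist R F m n) (@W R F m n tau))%E.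
Proof.
move=> i0min; have tau0 j : 0 < tau j by exact: lt_trans (tau_gt1 j).
pose v := profile m tau (tau i0) / tau i0.
have smin : dim_exponent m tau i0 = n%:R * (m%:R - 1) + v by exact: dim_exponentE.
have vtau j : v * tau j <= profile m tau (tau j).
  by rewrite -ler_pdivlMr//; have := i0min j; rewrite !dim_exponentE lerD2l.
have v0 : 0 < v.
  rewrite divr_gt0// /profile ltr_wpDr ?sumr_ge0//.
    by move=> r _; rewrite le_max lexx.
  by rewrite ltr_wpDl// ltr0n.
(* At the largest exponent, [profile] is at most [n * tau j] by [tau_sum]. *)
have vn : v <= n%:R.
  case: (@arg_maxP _ _ _ i0 xpredT tau isT) => j _ jmax.
  rewrite -(ler_pM2r (tau0 j)); apply: le_trans (vtau j) _.
  rewrite /profile (eq_bigr (fun r => tau j - tau r)); last first.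
    by move=> r _; rewrite max_r// subr_ge0; exact: jmax.
  rewrite sumrB sumr_const card_ord -[tau j *+ n]mulr_natl.
  by rewrite addrCA gerDl subr_le0.
apply: le_ereal_inf_tmp => _ [s' [s'0 H0] <-].
rewrite lee_fin leNgt smin; apply/negP => s's.
exact: hmeasure_W_neq0 v0 vn vtau s'0 s's H0.
Qed.

End MassTransference.

(** * The upper bound *)

Section Covers.
Variables (R : realType) (T : Type) (d : T -> T -> R).

Lemma nneseries_le_bound (u : nat -> \bar R) (C : \bar R) :
  (forall k, (0 <= u k)%E) -> (forall M, (\sum_(0 <= k < M) u k <= C)%E) ->
  (\sum_(0 <= k <oo) u k <= C)%E.
Proof.
move=> u0 uC; apply: lime_le.
  by apply: is_cvg_nneseries => k _ _; exact: u0.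
by apply: nearW => M; exact: uC.
Qed.

(** Countably many finite families form a countable cover. *)
Lemma hpremeasure_double s delta (A : set T) (V : nat -> nat -> set T) :
  A `<=` \bigcup_i \bigcup_k V i k ->
  (forall i k, (diam d (V i k) <= delta%:E)%E) ->
  (hpremeasure d s delta A
    <= \sum_(0 <= i <oo) \sum_(0 <= k <oo) hcost d s (V i k))%E.
Proof.
move=> AV Vd; have /ppcard_eqP[f] : ([set: nat] #= [set: nat * nat])%card.
  by rewrite card_eq_sym; exact: card_nat2.
pose U i := V (f i).1 (f i).2.
have -> : (\sum_(0 <= i <oo) \sum_(0 <= k <oo) hcost d s (V i k)
    = \sum_(0 <= i <oo) hcost d s (U i))%E.
  rewrite [LHS]nneseries_esumT; last first.
    move=> i; apply: nneseries_ge0 => k _ _; exact: hcost_ge0.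
  under eq_esum => i _.
    rewrite nneseries_esumT; last by move=> k; exact: hcost_ge0.
    over.
  rewrite esum_esum; last by move=> i k _ _; exact: hcost_ge0.
  rewrite [RHS]nneseries_esumT; last by move=> i; exact: hcost_ge0.
  rewrite (_ : setT `*`` (fun=> setT) = setT); last by apply/seteqP; split.
  by rewrite (@reindex_esum _ _ _ setT setT f)//; exact: bijTT.
apply: ereal_inf_lbound; exists U => //; split=> [x /AV[i _ [k _ xV]]|i].
  have [g _ gK] : bijective f by exact: bijTT.
  by exists (g (i, k)) => //; rewrite /U gK.
exact: Vd.
Qed.

End Covers.

Section UpperBound.
Variables (R : realType) (F : finFieldType) (m n : nat) (tau : 'I_n -> R).
Local Notation t := (#|F|%:R : R).
Local Notation IJ := ('I_m * 'I_n)%type.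
Hypothesis tau_gt1 : forall j, 1 < tau j.

Let t1 : 1 < t. Proof. exact: card_gt1. Qed.
Let t0 : 0 < t. Proof. exact: lt_trans t1. Qed.

Variable j0 : 'I_n.

Let level (d : nat) (r : 'I_n) := Num.truncn ((tau r - 1) * d%:R).

Let level_le d r : (level d r)%:R <= (tau r - 1) * d%:R.
Proof. by rewrite truncn_le mulr_ge0// subr_ge0 ltW. Qed.

Let level_gt d r : (tau r - 1) * d%:R < (level d r)%:R + 1.
Proof. by rewrite natr1; exact: truncnS_gt. Qed.

(** The length [d + level d j0] is that at which the equations of the column
    [j0] are decided; columns with larger [tau] would need longer prefixes, and
    only part of their equations is used. *)
Let prefixes (d : nat) : {set {ffun IJ * 'I_(d + level d j0) -> F}} :=
  approximable d.+1 d 0 (d + level d j0)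
    (fun r => minn (level d r) (level d j0)) (fun _ _ => 0).

Let cell (d : nat) (x : {ffun IJ * 'I_(d + level d j0) -> F}) :
    set 'M[laurent F]_(m, n) :=
  [set A | @unit_ball R F m n A /\ agree (d + level d j0) (digits A) (extend x)].

Let cell_diam d x : (diam (@mxdist R F m n) (@cell d x)
  <= (t `^ (- (d + level d j0)%:R))%:E)%E.
Proof.
apply: diam_le => [|A B [uA Ax] [uB Bx]]; first exact: powR_ge0.
apply: (@le_trans _ _ (t `^ (- (d + level d j0).+1%:R))).
  by apply: agree_mxdist => //; exact: agree_trans Ax (agree_sym Bx).
by rewrite ler_powR ?(ltW t1)// lerN2 ler_nat.
Qed.

Let cell_cover D A : @W R F m n tau A -> exists d, (D <= d)%N /\
  exists2 x, x \in prefixes d & @cell d x A.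
Proof.
move=> AW; have [c [i0 [d [Dd [c0 cd] hc]]]] := digits_W AW D.
exists d; split=> //; exists (truncate (d + level d j0) (digits A)); last first.
  by split; [case: AW | apply: agree_sym; exact: extend_truncate].
rewrite inE; apply/asboolP; split=> //.
exists (truncate d.+1 c), i0, d; split; first by rewrite leqnn ltnSn.
  split; first by rewrite extend_truncate.
  by move=> i e de; rewrite extend_ge.
move=> j l; rewrite leq_min => /andP[lj lj0].
rewrite -[RHS](hc j l); last by apply: le_trans (level_le d j); rewrite ler_nat.
apply: eq_pairing => [i e ed|i p pl]; first by rewrite extend_truncate.
by rewrite /column extend_truncate//; lia.
Qed.

(** By [card_approximable] the number of cells has exponent
    [m * (d + 1) + m * n * N - S] with [N] about [tau j0 * d]. Inserting the
    levels, the coefficient of [d] is [tau j0 * dim_exponent m tau j0]; the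
    constant [C] collects the roundings. *)
Let cell_cost s : exists C : R, forall d,
  #|prefixes d|%:R * t `^ (- ((d + level d j0)%:R * s))
  <= t `^ (C - tau j0 * (s - dim_exponent m tau j0) * d%:R).
Proof.
pose k : R := m%:R * n%:R - s.
exists (m%:R + n%:R + `|k|) => d.
have F0 : (0 < #|F|)%N by apply/card_gt0P; exists 0.
set N := (d + level d j0)%N.
pose S := (\sum_(r < n) minn (level d r) (level d j0))%N.
have cP : (#|prefixes d| * #|F| ^ S <= #|F| ^ (m * d.+1 + m * n * N))%N.
  have := @card_approximable F m n d.+1 d 0 N
    (fun r => minn (level d r) (level d j0)) (fun _ _ => 0).
  rewrite subn0; under eq_bigr => r _ do rewrite sub0n subn0.
  by apply=> r; rewrite /N; lia.
move: cP; rewrite -(ler_nat R) natrM !natrX -!powR_mulrn ?(ltW t0)// => cP.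
have powD x z : t `^ (x + z) = t `^ x * t `^ z.
  by rewrite powRD// (gt_eqF t0) /= implybT.
rewrite -(ler_pM2r (powR_gt0 S%:R t0)) mulrAC.
apply: le_trans (ler_wpM2r (powR_ge0 _ _) cP) _.
rewrite -!powD; apply: ler_powR; first exact: ltW.
have tau0 : 0 < tau j0 by exact: lt_trans (tau_gt1 j0).
have hN : k * N%:R <= k * (tau j0 * d%:R) + `|k|.
  have := level_le d j0; have := level_gt d j0.
  rewrite /N natrD; move: ((level d j0)%:R) (d%:R : R) => z e h1 h2.
  have [k0|k0] := leP 0 k.
    rewrite ger0_norm//; apply: (@le_trans _ _ (k * (tau j0 * e))); last by lra.
    by rewrite ler_wpM2l//; lra.
  rewrite ltr0_norm//.
  have : k * (e + z) <= k * (tau j0 * e - 1) by rewrite ler_nM2l//; lra.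
  by lra.
have hS : n%:R * (tau j0 * d%:R) - n%:R * d%:R - n%:R
    - d%:R * (profile m tau (tau j0) - n%:R - m%:R) <= S%:R.
  rewrite /profile (_ : _ + _ + _ - n%:R - m%:R
    = \sum_(r < n) Num.max 0 (tau j0 - tau r)); last by ring.
  have -> : n%:R * (tau j0 * d%:R) - n%:R * d%:R - n%:R
      - d%:R * (\sum_(r < n) Num.max 0 (tau j0 - tau r))
     = \sum_(r < n) (tau j0 * d%:R - d%:R - 1 - d%:R * Num.max 0 (tau j0 - tau r)).
    rewrite sumrB -mulr_sumr sumr_const card_ord -mulr_natl; ring.
  rewrite natr_sum; apply: ler_sum => r _.
  have := level_gt d r; have := level_gt d j0.
  have d0 : 0 <= d%:R :> R by [].
  have [rj|jr] := leqP (level d r) (level d j0).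
    have : d%:R * (tau j0 - tau r) <= d%:R * Num.max 0 (tau j0 - tau r).
      by rewrite ler_wpM2l// le_max lexx orbT.
    by lra.
  have : 0 <= d%:R * Num.max 0 (tau j0 - tau r).
    by rewrite mulr_ge0// le_max lexx.
  by lra.
have hE : tau j0 * dim_exponent m tau j0
    = n%:R * (m%:R - 1) * tau j0 + profile m tau (tau j0).
  by rewrite dim_exponentE mulrDr (mulrC _ (_ / _)) divfK ?gt_eqF// (mulrC (tau j0)).
rewrite natrD !natrM -natr1.
have -> : tau j0 * (s - dim_exponent m tau j0) * d%:R
   = (tau j0 * s - (n%:R * (m%:R - 1) * tau j0 + profile m tau (tau j0))) * d%:R.
  by rewrite -hE; ring.
by move: hN hS; rewrite /k; lra.
Qed.

Lemma hmeasure_W_eq0 s : 0 <= s -> dim_exponent m tau j0 < s ->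
  hmeasure (@mxdist R F m n) s (@W R F m n tau) = 0%E.
Proof.
move=> s0 js; have [C hC] := cell_cost s.
pose eta := tau j0 * (s - dim_exponent m tau j0).
have eta0 : 0 < eta.
  by rewrite mulr_gt0 ?subr_gt0//; exact: lt_trans (tau_gt1 j0).
pose q := t `^ (- eta).
have q0 : 0 < q by exact: powR_gt0.
have q1 : q < 1.
  by rewrite -[ltRHS](powRr0 t); apply: gt1_ltr_powR => //; rewrite oppr_lt0.
have tq d : t `^ (C - eta * d%:R) = t `^ C * q ^+ d.
  rewrite powRD ?(gt_eqF t0) /= ?implybT// -powR_mulrn ?(ltW q0)// -powRrM.
  by rewrite mulNr.
apply/eqP; rewrite eq_le; apply/andP; split; last first.
  apply: le_trans (ereal_sup_ubound _); last by exists 1 => //=; exact: ltr01.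
  exact: hpremeasure_ge0.
apply: ge_ereal_sup => _ [delta /= delta0 <-].
apply/lee_addgt0Pr => e e0; rewrite add0e.
have [D [Dd De]] : exists D, t `^ (- D%:R) <= delta /\ t `^ C * q ^+ D / (1 - q) <= e.
  have [D1 h1] := @powR_small R F _ _ ltr01 delta0.
  have ze0 : 0 < e * (1 - q) / t `^ C by rewrite divr_gt0 ?powR_gt0 ?mulr_gt0 ?subr_gt0.
  have [D2 h2] := @powR_small R F _ _ eta0 ze0.
  exists (D1 + D2)%N; split.
    apply: le_trans (ltW h1); rewrite ler_powR ?(ltW t1)// mul1r lerN2 ler_nat.
    exact: leq_addr.
  rewrite ler_pdivrMr ?subr_gt0// mulrC -ler_pdivlMr ?powR_gt0//.
  apply: le_trans (ltW h2); rewrite -mulNr powRrM powR_mulrn ?powR_ge0// -/q.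
  by rewrite exprD ler_piMl ?exprn_ge0 ?(ltW q0)// exprn_ile1 ?(ltW q0) ?(ltW q1).
pose cells d : seq (set 'M[laurent F]_(m, n)) :=
  [seq @cell (D + d) x | x <- enum (prefixes (D + d))].
pose V d k := nth set0 (cells d) k.
have V_diam d k : (diam (@mxdist R F m n) (V d k)
    <= (t `^ (- (D + d + level (D + d) j0)%:R))%:E)%E.
  rewrite /V; have [ks|ks] := ltnP k (size (cells d)); last first.
    rewrite nth_default//; apply: diam_le => //; exact: powR_ge0.
  move: ks; rewrite size_map => ks.
  have [x _] : exists x, x \in prefixes (D + d).
    by case: (enum _) ks (mem_enum (mem (prefixes (D + d)))) => // x u _ /(_ x);
       rewrite mem_head => xP; exists x.
  by rewrite (nth_map x).
have Wcov : @W R F m n tau `<=` \bigcup_d \bigcup_k V d k.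
  move=> A /(cell_cover D)[d [Dd' [x xP Ax]]].
  move: x xP Ax; rewrite -(subnKC Dd'); move: (d - D)%N => d' x xP Ax.
  exists d' => //; exists (index x (enum (prefixes (D + d')))) => //.
  by rewrite /V (nth_map x) ?index_mem ?mem_enum// nth_index ?mem_enum.
apply: (le_trans (hpremeasure_double s Wcov (delta := delta) _)) => [d k|].
  apply: le_trans (V_diam d k) _; rewrite lee_fin; apply: le_trans Dd.
  by rewrite ler_powR ?(ltW t1)// lerN2 ler_nat -addnA leq_addr.
have V_cost d : (\sum_(0 <= k <oo) hcost (@mxdist R F m n) s (V d k)
    <= (t `^ C * q ^+ (D + d))%:E)%E.
  pose sz := size (cells d).
  rewrite (nneseries_split _ sz); last by move=> k _; exact: hcost_ge0.
  rewrite [X in (_ + X)%E]eseries0 ?adde0; last first.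
    move=> k; rewrite add0n => szk _.
    by rewrite /hcost /V nth_default// eqxx.
  rewrite add0n.
  apply: (@le_trans _ _ (\sum_(0 <= k < sz)
      (t `^ (- ((D + d + level (D + d) j0)%:R * s)))%:E)%E).
    apply: lee_sum => k _; rewrite /hcost; case: ifP => _.
      by rewrite lee_fin powR_ge0.
    rewrite -mulNr powRrM -poweR_EFin; apply: gt0_ler_poweR => //.
    - by rewrite in_itv /= diam_ge0 leey.
    - by rewrite in_itv /= lee_fin powR_ge0 leey.
  rewrite sumEFin lee_fin sumr_const_nat subn0 /sz size_map -cardE.
  by rewrite -[leLHS]mulr_natl -tq; exact: hC.
apply: nneseries_le_bound => [d|M].
  by apply: nneseries_ge0 => k _ _; exact: hcost_ge0.
apply: (@le_trans _ _ (\sum_(0 <= d < M) (t `^ C * q ^+ (D + d))%:E)%E).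
  by apply: lee_sum => d _.
rewrite sumEFin lee_fin; apply: le_trans De.
under eq_bigr => d _ do rewrite exprD mulrA.
rewrite -mulr_sumr ler_wpM2l ?mulr_ge0 ?powR_ge0 ?exprn_ge0 ?(ltW q0)//.
rewrite -[leRHS]mul1r ler_pdivlMr ?subr_gt0//.
elim: M => [|M IH]; first by rewrite big_geq// mul0r.
have -> : \sum_(0 <= d < M.+1) q ^+ d = 1 + q * \sum_(0 <= d < M) q ^+ d.
  rewrite big_nat_recl//= expr0 mulr_sumr; congr (_ + _).
  by apply: eq_bigr => d _; rewrite exprS.
have := ler_wpM2l (ltW q0) IH; move: q1.
by lra.
Qed.

Lemma hdim_W_le : (0 < m)%N ->
  (hdim (@mxdist R F m n) (@W R F m n tau) <= (dim_exponent m tau j0)%:E)%E.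
Proof.
move=> m0; have j0_ge0 : 0 <= dim_exponent m tau j0.
  rewrite dim_exponentE addr_ge0//.
    by rewrite mulr_ge0// subr_ge0 ler1n.
  rewrite divr_ge0 ?(ltW (lt_trans _ (tau_gt1 j0)))// /profile addr_ge0//.
  by apply: sumr_ge0 => r _; rewrite le_max lexx.
apply/lee_addgt0Pr => e e0; apply: ereal_inf_lbound.
exists (dim_exponent m tau j0 + e) => //; split; first by rewrite addr_ge0// ltW.
by apply: hmeasure_W_eq0; [rewrite addr_ge0// ltW | rewrite ltrDl].
Qed.

End UpperBound.

Theorem theorem14 (R : realType) (F : finFieldType) (n m : nat)
    (n_gt0 : (0 < n)%N) (m_gt0 : (0 < m)%N) (tau : 'I_n -> R)
    (tau_gt1 : forall j, 1 < tau j)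
    (tau_sum : n%:R + m%:R <= \sum_(j < n) tau j) :
  hdim (@mxdist R F m n) (@W R F m n tau)
  = \big[Order.min/+oo%E]_(j < n) (dim_exponent m tau j)%:E.
Proof.
have [i0 i0min] : exists i0, forall j, dim_exponent m tau i0 <= dim_exponent m tau j.
  case: (@arg_minP _ _ _ (Ordinal n_gt0) xpredT (dim_exponent m tau) isT) => i _ imin.
  by exists i => j; exact: imin.
apply/eqP; rewrite eq_le; apply/andP; split.
  by apply/bigmin_geP; split=> [|j _]; [rewrite leey | exact: hdim_W_le].
by apply: le_trans (bigmin_le _ i0 _) _; exact: hdim_W_ge.
Qed.
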